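(* Let $d\ge 1$ and let $\omega_1,\ldots,\omega_d$ be positive real numbers such that $1,\omega_1,\ldots,\omega_d$ form a $\mathbb{Q}$-basis for an algebraic number field $\Phi\subset\mathbb{R}$. For $\mathcal{E}>1$ let $\varepsilon_1(\mathcal{E})<\cdots<\varepsilon_{\ell(\mathcal{E})}(\mathcal{E})$ be the energy levels in the window $[\mathcal{E},\mathcal{E}+1)$ (see context), and let $\delta_i(\mathcal{E})=\varepsilon_{i+1}(\mathcal{E})-\varepsilon_i(\mathcal{E})$ for $1\le i\le\ell(\mathcal{E})-1$. Then there exists a finite set $\mathcal{R}=\{r_1,\ldots,r_J\}\subset\Phi$ (with $r_1,\ldots,r_J$ distinct) such that the following hold. (1) (Uniform set of ratios) For every $\mathcal{E}>1$ the ratios of neighboring spacings satisfy $$\rho_i(\mathcal{E}):=\frac{\delta_i(\mathcal{E})}{\delta_{i-1}(\mathcal{E})}\in\mathcal{R}\qquad\text{for } 2\le i\le\ell(\mathcal{E})-1.$$ (2) (Quasiperiodicity) For $1\le j\le J$ let $p_j(\mathcal{E})$ denote the proportion of the ratios of neighboring spacings $\rho_i(\mathcal{E})$, $2\le i\le \ell(\mathcal{E})-1$, such that $\rho_i(\mathcal{E})=r_j$. Then there are integers $0\le k,r\le d+1$, a Lipschitz continuous function $$h:\mathbb{T}^k\times[0,1]^r\to P:=\Bigl\{(p_1,\ldots,p_J):\ \textstyle\sum_j p_j=1,\ p_j\ge 0\Bigr\},$$ angles $\boldsymbol{\theta}=(\theta_1,\ldots,\theta_k)\in\mathbb{R}^k$,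 rates $\boldsymbol{\beta}=(\beta_1,\ldots,\beta_r)\in\mathbb{R}^r$, and $0<\alpha<1$ such that, as $\mathcal{E}\to\infty$, $$(p_1(\mathcal{E}),\ldots,p_J(\mathcal{E})) = h\bigl(\boldsymbol{\theta}\log\mathcal{E},\ \{\boldsymbol{\beta}\log\mathcal{E}\}\bigr)+\mathcal{O}(\alpha^{\log\mathcal{E}}).$$
   Context: The energy levels (of the $(d+1)$-dimensional quantum harmonic oscillator with ratios of frequencies $\omega_1,\ldots,\omega_d>0$, in normalized energy units) are the real numbers of the form $\varepsilon=m_0+m_1\omega_1+\cdots+m_d\omega_d$ with $m_0,\ldots,m_d$ non-negative integers. For $\mathcal{E}>1$, $\ell(\mathcal{E})$ is the number of energy levels in $[\mathcal{E},\mathcal{E}+1)$ and $\varepsilon_1(\mathcal{E})<\cdots<\varepsilon_{\ell(\mathcal{E})}(\mathcal{E})$ lists them in increasing order. $\mathbb{T}=\mathbb{R}/\mathbb{Z}$; the vector $\boldsymbol{\theta}\log\mathcal{E}\in\mathbb{R}^k$ is reduced modulo $\mathbb{Z}^k$ to give a point of $\mathbb{T}^k$. $\{x\}$ denotes the fractional part of a real number $x$, and $\{\boldsymbol{\beta}\log\mathcal{E}\}:=(\{\beta_1\log\mathcal{E}\},\ldots,\{\beta_r\log\mathcal{E}\})\in[0,1]^r$. The error term $\mathcal{O}(\cdot)$ for vectors is understood componentwise. *)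

(* Defs.v *)
From mathcomp Require Export all_boot all_order all_algebra all_field.
From mathcomp Require Export finmap.
From mathcomp Require Export all_classical all_reals all_analysis.
Export Order.TTheory GRing.Theory Num.Theory.
Export numFieldNormedType.Exports Quotient.

Set Implicit Arguments.
Unset Strict Implicit.
Unset Printing Implicit Defensive.

#[global] Open Scope classical_set_scope.
#[global] Open Scope ring_scope.

Section EnergyLevels.
Context {R : realType} {d : nat}.
Variable omega : 'I_d -> R.
Implicit Types (E x : R) (i : nat).

Definition energy_level : set R :=
  [set x | exists (m0 : nat) (m : 'I_d -> nat),
    x = m0%:R + \sum_(j < d) (m j)%:R * omega j].

Definition window E : set R := energy_level `&` [set x | E <= x < E + 1].

(* [fset_set A] is empty when [A] is infinite; [mem_levels] below shows that
   this does not occur here. *)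
Definition levels E : seq R := sort <=%R (enum_fset (fset_set (window E))).

Definition nlevels E : nat := size (levels E).

(* Levels, spacings and ratios are numbered from 1. *)
Definition level E i : R := nth 0 (levels E) i.-1.

Definition spacing E i : R := level E i.+1 - level E i.

Definition spacing_ratio E i : R := spacing E i / spacing E i.-1.

(* The ratios have indices 2, ..., nlevels E - 1; with no ratio at all the
   proportion is 0 / 0 = 0, which for d > 0 happens only for bounded E. *)
Definition ratio_proportion E (r : R) : R :=
  (\sum_(2 <= i < nlevels E) (spacing_ratio E i == r))%N%:R
  / (nlevels E - 2)%N%:R.

Lemma finite_window E : (forall j, 0 < omega j) -> finite_set (window E).
Proof.
move=> omega_gt0.
pose N := (Num.bound (E + 1) + \sum_(j < d) Num.bound ((E + 1) / omega j))%N.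
pose f (u : 'I_N * {ffun 'I_d -> 'I_N}) : R :=
  u.1%:R + \sum_(j < d) (u.2 j)%:R * omega j.
apply: (@sub_finite_set _ _ (range f)); last first.
  exact/finite_image/finite_finset.
move=> x [[m0 [m ->]]] /= /andP[_ ltE].
have le0 j : 0 <= (m j)%:R * omega j by rewrite mulr_ge0// ltW.
have m0N : (m0 < N)%N.
  apply: leq_trans (leq_addr _ _); rewrite -(ltr_nat R).
  apply: le_lt_trans (truncnS_gt _).
  rewrite (le_trans _ (ler_norm _))// (le_trans _ (ltW ltE))//.
  by rewrite lerDl sumr_ge0.
have mN j : (m j < N)%N.
  apply: leq_trans (leq_addl _ _); rewrite (bigD1 j)//=.
  apply: leq_trans (leq_addr _ _); rewrite -(ltr_nat R).
  apply: le_lt_trans (truncnS_gt _).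
  rewrite (le_trans _ (ler_norm _))// ler_pdivlMr// (le_trans _ (ltW ltE))//.
  by rewrite (bigD1 j)//= addrCA lerDl addr_ge0// sumr_ge0.
exists (Ordinal m0N, [ffun j => Ordinal (mN j)]) => //.
by rewrite /f /=; congr (_ + _); apply: eq_bigr => j _; rewrite ffunE.
Qed.

Lemma mem_levels E x : (forall j, 0 < omega j) ->
  x \in levels E <-> energy_level x /\ E <= x < E + 1.
Proof.
move=> /(finite_window E) finE; rewrite mem_sort in_fset_set//.
by split=> [/set_mem|/mem_set].
Qed.

Lemma levels_sorted E : sorted <%R (levels E).
Proof. by rewrite lt_sorted_uniq_le sort_uniq fset_uniq sort_le_sorted. Qed.

End EnergyLevels.

Section Torus.
Context {R : realType}.

(* R / Z as a quotient group; [Num.int_num_subdef] is the predicate behind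
   [Num.int]. *)
Definition circle : Type :=
  quot (GRing.ZmodClosed.clone R (@Num.int_num_subdef R) _).

Definition to_circle (x : R) : circle := (\pi_circle x)%qT.

(* The quotient metric. *)
Definition circle_dist (p q : circle) : R :=
  inf [set z | exists x y, [/\ to_circle x = p, to_circle y = q
                             & z = `|x - y|]].

Definition torus_dist {k : nat} (p q : 'rV[circle]_k) : R :=
  \big[Num.max/0]_(i < k) circle_dist (p 0 i) (q 0 i).

Definition to_torus {k : nat} (x : 'rV[R]_k) : 'rV[circle]_k :=
  map_mx to_circle x.

Definition frac (x : R) : R := x - (Num.floor x)%:~R.

Definition unit_cube (s : nat) : set 'rV[R]_s :=
  [set y | forall i, 0 <= y 0 i <= 1].

Definition simplex (J : nat) : set 'rV[R]_J :=
  [set p | \sum_(j < J) p 0 j = 1 /\ forall j, 0 <= p 0 j].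

(* Only the values of [h] at [x, y] with [y] in the unit cube matter; the
   product carries the maximum of the two distances. *)
Definition torus_cube_lipschitz {k s J : nat}
    (h : 'rV[circle]_k -> 'rV[R]_s -> 'rV[R]_J) : Prop :=
  exists K : R, forall x x' y y', unit_cube y -> unit_cube y' ->
    `|h x y - h x' y'| <= K * Num.max (torus_dist x x') `|y - y'|.

End Torus.
Arguments circle : clear implicits.

(* Main.v *)
Require Import Defs.
From HB Require Import structures.
From mathcomp Require Import complex ring lra zify.
Import Normc.
Set Implicit Arguments.
Unset Strict Implicit.
Unset Printing Implicit Defensive.

(** The additive group M generated by 1, omega_1, ..., omega_d is a lattice in the
    number field Phi, and the energy levels are the values in R of the points of
    M with nonnegative coordinates.  So the levels in [E, E + 1) form a
    cut-and-project set: the window in the d internal directions is a simplex of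
    size E, and gaps have size about E^-d.  Units u of the ring of multipliers of M
    act on M, scaling the physical coordinate by u and the internal ones by the
    other conjugates of u.

    There are units that undo the change of scale.  Dirichlet's box principle
    gives elements of M of size Q^-d in R with all other conjugates of size Q;
    their norms are bounded, so that quotients of congruent ones are units whose
    logarithmic vectors are ln Q * (-d, 1, ..., 1) + O(1).  Hence (-d, 1, ..., 1) is
    a real combination, with coefficients beta, of logarithmic vectors of
    independent units u_i (logdir_unit_span).  At scale E one uses the product of
    the u_i to the powers floor (beta_i ln E).  Its conjugates divided by E are
    determined, up to O(1/E), by the fractional parts of beta ln E and, for the
    arguments, by theta ln E modulo 1 (renormalization).

    After multiplication by the inverse of this unit, all differences of
    neighbouring levels lie in one finite set of elements of M, which does not
    depend on E (neighbour_difference).  A ratio of neighbouring spacings is a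
    quotient of two of them, and the unit cancels; this is the first part of the
    theorem (spacing_ratio_label).

    Which quotient occurs at a level is decided by comparing each of its
    coordinates with finitely many walls, at heights that, relative to E and up
    to O(1/E), are Lipschitz functions of the phase, that is of the point
    (theta ln E, frac (beta ln E)).  So a proportion p(E) is a ratio of
    numbers of lattice points in cells of a dilated simplex.  No volume is
    computed: counts at two scales E and E' are compared directly, by coupling the
    cubes of side 1/E with the cubes of side 1/E' (coupling, compare_cells), which
    gives |p(E) - p(E')| <= K (distance of the phases + 1/E + 1/E')
    (proportion_quasi).  Such a function extends, by McShane's infimum formula
    followed by a Lipschitz retraction onto the simplex, to a Lipschitz function h
    of the phase with p(E) = h(phase of E) + O(1/E) (extension), and
    1/E = alpha^(ln E) for alpha = exp(-1).

    The torus coordinates are the arguments of all d + 1 embeddings, and the cube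
    has one coordinate for each u_i. *)

(** * Complex embeddings of a number field *)
(** An element generating a subfield of largest dimension generates everything:
    otherwise the primitive element theorem, applied to it and to an element
    outside its field, would produce a larger simple extension. *)
Lemma primitive_element_rat (L : fieldExtType rat) :
  exists x : L, <<1%VS; x>>%VS = fullv.
Proof.
pose P m := `[< exists x : L, \dim <<1%VS; x>> = m >].
have exP : exists m, P m by exists (\dim <<1%VS; (0 : L)>>); apply/asboolP; exists 0.
have ubP m : P m -> (m <= \dim (fullv : {vspace L}))%N.
  by move=> /asboolP[x <-]; rewrite dimvS ?subvf.
case: (ex_maxnP exP ubP) => m /asboolP[x dimx] maxm.
exists x; apply/eqP; rewrite eqEsubv subvf /=; apply/subvP => y _.
have sep : separable_element 1%AS x.
  apply: pcharf0_separable => p; rewrite (fmorph_pchar (in_alg L)).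
  exact: pchar_num.
have [z ez] := Primitive_Element_Theorem y sep.
have /maxm : P (\dim <<1%VS; z>>) by apply/asboolP; exists z.
rewrite -dimx -ez => le.
have sub : (<<1%VS; x>> <= <<<<1%VS; x>>; y>>)%VS by exact: subv_adjoin.
have /eqP -> : (<<1%VS; x>>)%VS == (<<<<1%VS; x>>; y>>)%VS by rewrite eqEdim sub le.
exact: memv_adjoin.
Qed.

(** The embeddings evaluate polynomials in a primitive element x at the roots of
    its minimal polynomial, so that the matrix of conjugates of the powers of x
    is a Vandermonde matrix with distinct nodes.  The given embedding f0 is
    kept in the list because it is the physical coordinate of the problem. *)
Lemma embeddings (L : fieldExtType rat) (C : numClosedFieldType)
    (f0 : {rmorphism L -> C}) (n : nat) (b : n.-tuple L) :
  basis_of fullv b ->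
  exists (sigma : 'I_n -> {rmorphism L -> C}) (k1 : 'I_n),
    (forall x, sigma k1 x = f0 x) /\
    \matrix_(i, k) sigma k b`_i \in unitmx.
Proof.
move=> b_basis.
have [x genx] := primitive_element_rat L.
pose toL := map_poly (in_alg L); pose toC := map_poly (ratr : rat -> C).
have [q Dq] : exists q, minPoly 1%AS x = toL q.
  exact/polyOver1P/minPolyOver.
have exP y : exists p, (toL p).[x] = y.
  have /polyOver1P[p Dp] := Fadjoin_polyOver 1%AS x y.
  by exists p; rewrite /toL -Dp Fadjoin_poly_eq // genx memvf.
have [P PE] := choice exP.
have q_dvd p : (toL p).[x] = 0 -> q %| p.
  move=> px; rewrite -(dvdp_map (in_alg L)) -/(toL q) -Dq.
  by apply: minPoly_dvdp; [apply/polyOver1P; exists p | apply/rootP].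
have ev0 z p : root (toC q) z -> (toL p).[x] = 0 -> (toC p).[z] = 0.
  move=> qz /q_dvd; rewrite -(dvdp_map (ratr : {rmorphism rat -> C})) => dv.
  by apply/rootP; rewrite -dvdp_XsubCl (dvdp_trans _ dv) // dvdp_XsubCl.
have evE z p p' : root (toC q) z -> (toL p).[x] = (toL p').[x] ->
    (toC p).[z] = (toC p').[z].
  move=> qz pp; apply/eqP; rewrite -subr_eq0 -hornerN -hornerD /toC -rmorphB /=.
  by apply/eqP/ev0 => //; rewrite /toL rmorphB /= hornerD hornerN -/toL pp subrr.
have mor z (qz : root (toC q) z) :
    exists s : {rmorphism L -> C}, forall y, s y = (toC (P y)).[z].
  pose s y := (toC (P y)).[z].
  have sadd : zmod_morphism s.
    move=> y y'; rewrite /s -hornerN -hornerD /toC -rmorphB; apply: evE => //.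
    by rewrite PE /toL rmorphB /= hornerD hornerN !PE.
  have smul : monoid_morphism s.
    split; first rewrite /s -(hornerC 1 z) -[1%:P](rmorph1 (map_poly ratr)).
      by apply: evE => //; rewrite PE /toL rmorph1 hornerC.
    move=> y y'; rewrite /s -hornerM /toC -rmorphM; apply: evE => //.
    by rewrite PE /toL rmorphM hornerM !PE.
  pose add := GRing.isZmodMorphism.Build _ _ s sadd.
  pose mul := GRing.isMonoidMorphism.Build _ _ s smul.
  pose f : {rmorphism L -> C} := HB.pack s add mul.
  by exists f.
have dimn : \dim (fullv : {vspace L}) = n.
  exact: (size_basis b_basis).
have sizeq : size q = n.+1.
  have := size_minPoly 1%AS x; rewrite Dq size_map_poly => ->.
  by rewrite /adjoin_degree dimv1 divn1 prednK ?adim_gt0 // genx dimn.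
have sepq : separable_poly q.
  rewrite -(separable_map (in_alg L)) -/(toL q) -Dq.
  apply: pcharf0_separable => p; rewrite (fmorph_pchar (in_alg L)).
  exact: pchar_num.
have [rs Drs] := closed_field_poly_normal (toC q).
have lq0 : lead_coef (toC q) != 0.
  by rewrite lead_coef_eq0 map_poly_eq0 -size_poly_eq0 sizeq.
have urs : uniq rs.
  rewrite -(separable_prod_XsubC rs) -(eqp_separable (eqp_scale _ lq0)) -Drs.
  by rewrite separable_map.
have srs : size rs == n.
  have := congr1 (fun p : {poly C} => size p) Drs.
  by rewrite /= size_map_poly sizeq size_scale // size_prod_XsubC => -[->].
pose z (k : 'I_n) := tnth (Tuple srs) k.
have rz k : root (toC q) (z k).
  rewrite Drs rootZ // root_prod_XsubC; exact: mem_tnth.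
have [sg sgE] := choice (fun k => mor (z k) (rz k)).
have f0C (a : rat) : f0 (in_alg L a) = ratr a.
  exact: (fmorph_eq_rat (f0 \o in_alg L)).
have f0P p : f0 (toL p).[x] = (toC p).[f0 x].
  rewrite -horner_map -map_poly_comp; congr (_.[_]).
  by apply: eq_map_poly => a; exact: f0C.
have f0x : f0 x \in rs.
  rewrite -root_prod_XsubC -(rootZ _ _ lq0) -Drs; apply/rootP.
  by rewrite -f0P -Dq minPolyxx rmorph0.
have /tnthP[k1 Dk1] : f0 x \in Tuple srs by [].
exists sg, k1; split=> [y|]; first by rewrite sgE /z -Dk1 -f0P PE.
pose B : 'M[C]_n := \matrix_(i, j) ratr (coord b j (x ^+ i)).
pose V : 'rV[C]_n := \row_k z k.
have DV : B *m \matrix_(i, k) sg k b`_i = Vandermonde n V.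
  apply/matrixP => i k; rewrite !mxE.
  transitivity (sg k (x ^+ i)); last first.
    rewrite rmorphXn /= sgE; congr (_ ^+ _).
    rewrite -[RHS]hornerX -[in RHS](map_polyX (ratr : {rmorphism rat -> C})).
    by apply: evE => //; rewrite PE /toL map_polyX hornerX.
  rewrite [in RHS](coord_basis b_basis (memvf (x ^+ i))) rmorph_sum /=.
  apply: eq_bigr => j _; rewrite !mxE -mulr_algl rmorphM /=; congr (_ * _).
  by symmetry; exact: (fmorph_eq_rat (sg k \o in_alg L)).
rewrite unitmxE unitfE; apply/eqP => det0.
have := congr1 determinant DV; rewrite det_mulmx det0 mulr0 det_Vandermonde.
apply/eqP; rewrite eq_sym; apply/prodf_neq0 => i _; apply/prodf_neq0 => j ij.
rewrite !mxE subr_eq0 /z !(tnth_nth 0) /= nth_uniq ?(eqP srs) //.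
by rewrite neq_ltn ij orbT.
Qed.

(** * Multiplication matrices and integrality *)
Section Multiplication.
Variables (L : fieldExtType rat) (n : nat) (b : n.-tuple L).
Hypothesis b_basis : basis_of fullv b.

(** Matrices act on row vectors of coordinates: if v is the row of coordinates of
    y in the basis b, then v *m mulmat x is the row of coordinates of y * x. *)
Definition mulmat (x : L) : 'M[rat]_n := \matrix_(i, j) coord b j (b`_i * x).

Lemma mulmatE x (i : 'I_n) : b`_i * x = \sum_j mulmat x i j *: b`_j.
Proof.
rewrite [LHS](coord_basis b_basis (memvf _)).
by apply: eq_bigr => j _; rewrite mxE.
Qed.

Lemma mulmatM x y : mulmat (x * y) = mulmat x *m mulmat y.
Proof.
apply/matrixP => i j; rewrite mxE mulrA mulmatE mulr_suml linear_sum mxE.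
by apply: eq_bigr => k _; rewrite -scalerAl linearZ /= [mulmat y k j]mxE.
Qed.

Lemma mulmat1 : mulmat 1 = 1%:M.
Proof.
by apply/matrixP => i j; rewrite !mxE mulr1 coord_free ?(basis_free b_basis).
Qed.

Fact mulmat_is_linear : linear mulmat.
Proof.
move=> a x y; apply/matrixP => i j; rewrite !mxE mulrDr -scalerAr.
by rewrite linearP.
Qed.
HB.instance Definition _ := GRing.isLinear.Build rat L 'M[rat]_n _ mulmat
  mulmat_is_linear.

Definition integral_mx (A : 'M[rat]_n) : Prop :=
  exists B : 'M[int]_n, A = map_mx intr B.

Lemma integral_mxM A B : integral_mx A -> integral_mx B -> integral_mx (A *m B).
Proof. by move=> [A' ->] [B' ->]; exists (A' *m B'); rewrite map_mxM. Qed.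

Lemma integral_mxD A B : integral_mx A -> integral_mx B -> integral_mx (A + B).
Proof. by move=> [A' ->] [B' ->]; exists (A' + B'); rewrite map_mxD. Qed.

Lemma integral_mxN A : integral_mx A -> integral_mx (- A).
Proof. by move=> [A' ->]; exists (- A'); rewrite map_mxN. Qed.

Lemma integral_mx1 : integral_mx 1%:M.
Proof. by exists 1%:M; rewrite map_mx1. Qed.

Lemma integral_mx_sum (I : finType) (F : I -> 'M[rat]_n) :
  (forall i, integral_mx (F i)) -> integral_mx (\sum_i F i).
Proof.
move=> FP; apply: (big_ind integral_mx) => //; last exact: integral_mxD.
by exists 0; rewrite map_mx0.
Qed.

Lemma mulmat_unit x : x != 0 -> mulmat x \in unitmx.
Proof.
move=> x0; have := mulmatM x x^-1; rewrite divff // mulmat1 => /esym.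
by move/mulmx1_unit => [].
Qed.

Lemma mulmatV x : x != 0 -> mulmat x^-1 = invmx (mulmat x).
Proof.
move=> x0; apply: (row_full_inj (A := mulmat x)); rewrite ?row_full_unit ?mulmat_unit //.
by rewrite mulmxV ?mulmat_unit // -mulmatM divff // mulmat1.
Qed.

(** The structure constants of the basis b are rational, so that a common
    denominator N of them moves the lattice spanned by b into the ring of
    multipliers of that lattice. *)
Lemma mulmat_denominator : exists N : nat, (0 < N)%N /\
  forall v : 'I_n -> int, integral_mx (mulmat (N%:R * \sum_i (v i)%:~R * b`_i)).
Proof.
pose N : nat := (\prod_(p : 'I_n * 'I_n * 'I_n)
  `|denq (mulmat b`_p.1.1 p.1.2 p.2)|)%N.
exists N; split.
  by apply: prodn_gt0 => p; rewrite absz_gt0 denq_neq0.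
move=> v.
have int_entry (i j k : 'I_n) : (N%:R * mulmat b`_i j k) \is a Num.int.
  rewrite /N (bigD1 (i, j, k)) //= mulnC natrM -mulrA rpredM ?natr_int //.
  rewrite -[X in _ * X]divq_num_den natr_absz gtr0_norm ?denq_gt0 //.
  by rewrite mulrC divfK ?intr_int // intr_eq0 denq_neq0.
have -> : N%:R * (\sum_i (v i)%:~R * b`_i) = \sum_i ((v i)%:~R * N%:R : rat) *: b`_i.
  rewrite mulr_sumr; apply: eq_bigr => i _.
  by rewrite [_%:~R * N%:R]mulrC -scalerA scaler_nat scaler_int mulr_natl mulrzl.
rewrite linear_sum; apply: integral_mx_sum => i; rewrite linearZ /=.
exists (\matrix_(j, k) Num.floor ((v i)%:~R * N%:R * mulmat b`_i j k)).
apply/matrixP => j k; rewrite mxE [RHS]mxE [in RHS]mxE floorK // -mulrA.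
by rewrite rpredM ?intr_int.
Qed.

End Multiplication.

(** * Short elements and units along the expanding direction *)
(** Dirichlet's box principle: there are (Q + 1)^(d + 1) integer vectors with
    entries in [0, Q], more than the Q^(d + 1) bins into which the range of the
    linear form is cut, and the difference of two vectors in a common bin is the
    required v. *)
Lemma dirichlet_box (R : realType) (d : nat) (b : 'I_d.+1 -> R) :
  exists2 C : R, 0 < C & forall Q : nat, (0 < Q)%N ->
    exists v : 'I_d.+1 -> int, [/\ exists i, v i != 0,
      forall i, (`|v i| <= Q)%N & `|\sum_i (v i)%:~R * b i| <= C / Q%:R ^+ d].
Proof.
pose B := \sum_i `|b i|.
have B_ge0 : 0 <= B by exact: sumr_ge0.
exists (2 * B + 1); first by rewrite ltr_wpDl // mulr_ge0.
move=> Q Q_gt0; have Q0 : 0 < Q%:R :> R by rewrite ltr0n.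
have Q1 : 1 <= Q%:R :> R by rewrite ler1n.
pose T := {ffun 'I_d.+1 -> 'I_Q.+1}.
pose ell (u : T) := \sum_i (u i)%:R * b i.
have ellB u : `|ell u| <= B * Q%:R.
  rewrite (le_trans (ler_norm_sum _ _ _)) // mulr_suml ler_sum // => i _.
  by rewrite normrM mulrC ler_wpM2l // ger0_norm // ler_nat -ltnS.
(* The extra 1 keeps the largest value of the form inside the last bin. *)
pose w := (2 * B * Q%:R + 1) / Q%:R ^+ d.+1.
have w_gt0 : 0 < w by rewrite divr_gt0 ?exprn_gt0 // ltr_wpDl // !mulr_ge0.
pose bin u := Num.truncn ((ell u + B * Q%:R) / w).
have num_ge0 u : 0 <= ell u + B * Q%:R.
  by have := ellB u; rewrite ler_norml => /andP[]; lra.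
have bin_lt u : (bin u < Q ^ d.+1)%N.
  rewrite /bin truncn_lt_nat; last by rewrite divr_ge0 ?(ltW w_gt0).
  rewrite ltr_pdivrMr // natrX /w.
  rewrite mulrCA divff ?mulr1 ?expf_neq0 ?gt_eqF //.
  by have := ellB u; rewrite ler_norml => /andP[_]; lra.
pose f (u : T) : 'I_(Q ^ d.+1) := Ordinal (bin_lt u).
have /injectivePn[u [u' uu' fuu']] : ~~ injectiveb f.
  apply/negP => /injectiveP/leq_card.
  by rewrite card_ffun !card_ord leqNgt ltn_exp2r // ltnSn.
exists (fun i => (u i)%:Z - (u' i)%:Z); split.
- move: uu'; apply: contra_neqP => /forallNP same; apply/ffunP => i; apply/val_inj.
  by have /negP := same i; rewrite negbK subr_eq0 => /eqP[].
- by move=> i; have := ltn_ord (u i); have := ltn_ord (u' i); lia.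
have -> : \sum_i ((u i)%:Z - (u' i)%:Z)%:~R * b i = ell u - ell u'.
  by rewrite -sumrB; apply: eq_bigr => i _; rewrite rmorphB /= mulrBl.
apply: (@le_trans _ _ w).
  have /(congr1 val) /= e := fuu'.
  have binP t : (bin t)%:R * w <= ell t + B * Q%:R < (bin t).+1%:R * w.
    rewrite -ler_pdivlMr // -ltr_pdivrMr //.
    by rewrite truncn_itv // divr_ge0 // ltW.
  have := binP u; have := binP u'; rewrite -e -natr1 mulrDl mul1r ler_norml.
  by move=> /andP[? ?] /andP[? ?]; apply/andP; split; lra.
rewrite /w exprS invfM mulrA ler_pM2r ?invr_gt0 ?exprn_gt0 //.
by rewrite ler_pdivrMr //; nra.
Qed.

Lemma normc_prod (R : realType) (I : finType) (F : I -> R[i]) :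
  normc (\prod_i F i) = \prod_i normc (F i).
Proof. by elim/big_rec2: _ => [|i x y _ <-]; rewrite ?normc1 // normcM. Qed.

Lemma normc_sum (R : realType) (I : finType) (F : I -> R[i]) :
  normc (\sum_i F i) <= \sum_i normc (F i).
Proof.
elim/big_rec2: _ => [|i x y _ IH]; first by rewrite normc0.
by rewrite (le_trans (le_normcD _ _)) // lerD2l.
Qed.

Lemma normc_real (R : realType) (x : R) : normc x%:C%C = `|x|.
Proof. by rewrite /= expr0n /= addr0 sqrtr_sqr. Qed.

Lemma normc_ge0 (R : realType) (x : R[i]) : 0 <= normc x.
Proof. by case: x => x y /=; rewrite sqrtr_ge0. Qed.

Lemma normc_gt0 (R : realType) (x : R[i]) : x != 0 -> 0 < normc x.
Proof.
move=> x0; rewrite lt_neqAle normc_ge0 andbT eq_sym.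
by apply: contra_neq x0 => /eq0_normc.
Qed.

Section Units.
Variables (R : realType) (L : fieldExtType rat) (d : nat) (b : d.+1.-tuple L).
Hypothesis b_basis : basis_of fullv b.
Variables (iota : {rmorphism L -> R}) (sigma : 'I_d.+1 -> {rmorphism L -> R[i]}).
Variable k1 : 'I_d.+1.
Hypothesis sigma_k1 : forall x, sigma k1 x = (iota x)%:C%C.

Definition embmx : 'M[R[i]]_d.+1 := \matrix_(i, k) sigma k b`_i.
Hypothesis embmx_unit : embmx \in unitmx.

Local Notation A := (mulmat b).

Lemma mulmat_sigma x :
  map_mx ratr (A x) *m embmx = embmx *m diag_mx (\row_k sigma k x).
Proof.
apply/matrixP => i k; rewrite mul_mx_diag !mxE -rmorphM mulmatE // rmorph_sum.
apply: eq_bigr => j _; rewrite [map_mx _ _ _ _]mxE [embmx _ _]mxE.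
rewrite -mulr_algl rmorphM /=; congr (_ * _).
by rewrite -(fmorph_eq_rat (sigma k \o in_alg L)).
Qed.

Lemma det_mulmat x : ratr (\det (A x)) = \prod_k sigma k x.
Proof.
have := congr1 determinant (mulmat_sigma x).
rewrite !det_mulmx mulrC det_map_mx det_diag => /mulfI -> //.
  by apply: eq_bigr => k _; rewrite mxE.
Qed.

Lemma norm_det_mulmat x : `|ratr (\det (A x)) : R| = \prod_k normc (sigma k x).
Proof.
rewrite -normc_prod -det_mulmat -normc_real; congr normc.
by rewrite -(fmorph_eq_rat (real_complex R \o ratr)).
Qed.

Definition logemb (x : L) : 'rV[R]_d.+1 := \row_k ln (normc (sigma k x)).

Lemma normc_sigma_gt0 x k : x != 0 -> 0 < normc (sigma k x).
Proof. by move=> x0; rewrite normc_gt0 // fmorph_eq0. Qed.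

Lemma logembM x y : x != 0 -> y != 0 -> logemb (x * y) = logemb x + logemb y.
Proof.
move=> x0 y0; apply/rowP => k; rewrite !mxE rmorphM normcM lnM //;
  by rewrite posrE normc_sigma_gt0.
Qed.

Lemma logembV x : x != 0 -> logemb x^-1 = - logemb x.
Proof.
move=> x0; apply/rowP => k; rewrite !mxE fmorphV normcV lnV //.
by rewrite posrE normc_sigma_gt0.
Qed.

(** The tangent vector of the flow that contracts the physical coordinate (the
    place k1) by E^-d and expands all the others by E, so that the norm is kept. *)
Definition logdir : 'rV[R]_d.+1 := \row_k (if k == k1 then - d%:R else 1).

Lemma sum_logdir : \sum_k logdir 0 k = 0.
Proof.
rewrite (bigD1 k1) //= mxE eqxx (eq_bigr (fun=> 1)) => [|k /negPf kk1]; last first.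
  by rewrite mxE kk1.
by rewrite sumr_const cardC1 card_ord /= addNr.
Qed.

Definition near_logdir (C : R) (t : R) (x : L) : Prop :=
  forall k, `|logemb x 0 k - t * logdir 0 k| <= C.

(** The vectors given by Dirichlet's principle have conjugates of size at most Q^-d
    at the place k1 and at most Q elsewhere.  Their norm is bounded, and nonzero
    in a lattice, so that each of these upper bounds is also a lower bound up to a
    constant.  A single W makes W / a integral for all of them, because the
    determinants of their multiplication matrices are bounded. *)
Lemma short_elements : exists (C : R) (W : nat), (0 < W)%N /\
  forall Q : nat, (0 < Q)%N -> exists a, [/\ a != 0, integral_mx (A a),
    integral_mx (W%:R *: A a^-1) & near_logdir C (ln Q%:R) a].
Proof.
have [N [N_gt0 intN]] := mulmat_denominator b.
have [C0 C0_gt0 box] := dirichlet_box (fun i : 'I_d.+1 => iota b`_i).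
pose B := \sum_k \sum_(i < d.+1) normc (sigma k b`_i).
pose c := Num.max 0 (ln (N%:R * (C0 + B + 1))).
have c_ge0 : 0 <= c by rewrite le_max lexx.
have B_ge0 : 0 <= B by do 2!apply: sumr_ge0 => ? _; exact: normc_ge0.
(* The determinants are at most W0 in absolute value, so they divide W0`!. *)
pose W0 := (Num.truncn (expR (d.+1%:R * c))).+1.
have sum_le (x : L) t : (forall k, logemb x 0 k <= t * logdir 0 k + c) ->
    \sum_k logemb x 0 k <= d.+1%:R * c.
  move=> up; apply: le_trans (ler_sum _ (fun k _ => up k)) _.
  by rewrite big_split /= -mulr_sumr sum_logdir mulr0 add0r sumr_const card_ord mulr_natl.
exists (d.+1%:R * c), W0`!; split; first exact: fact_gt0.
move=> Q Q_gt0; have Q0 : 0 < Q%:R :> R by rewrite ltr0n.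
have [v [[i0 vi0] vQ vC]] := box _ Q_gt0.
pose y := \sum_i (v i)%:~R * b`_i; pose a := N%:R * y.
have y0 : y != 0.
  apply: contraNneq vi0 => ysum; pose X := in_tuple b.
  have /freeP free_b := basis_free b_basis.
  have := free_b (fun i => (v i)%:~R) _ i0.
  rewrite -(intr_eq0 rat) => -> //; rewrite -[RHS]ysum; apply: eq_bigr => i _.
  by rewrite scaler_int mulrzl.
have a0 : a != 0.
  by rewrite mulf_neq0 // -(rmorph_nat (in_alg L)) fmorph_eq0 pnatr_eq0 -lt0n.
have [D DE] := intN v; rewrite -/y -/a in DE.
have up k : logemb a 0 k <= ln Q%:R * logdir 0 k + c.
  have Nk : sigma k a = N%:R * sigma k y by rewrite rmorphM rmorph_nat.
  have a_gt0 := normc_sigma_gt0 k a0.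
  have N_ge1 : 1 <= N%:R :> R by rewrite ler1n.
  have cE : ln (N%:R * (C0 + B + 1)) <= c by rewrite le_max lexx orbT.
  have M_gt0 : 0 < N%:R * (C0 + B + 1) by rewrite mulr_gt0 ?ltr0n //; lra.
  suff : normc (sigma k a) <= expR (ln Q%:R * logdir 0 k) * (N%:R * (C0 + B + 1)).
    move=> le; rewrite mxE -ler_expR lnK ?posrE // expRD (le_trans le) //.
    by rewrite ler_wpM2l ?expR_ge0 // -[leLHS]lnK ?posrE // ler_expR.
  rewrite Nk normcM.
  have -> : normc N%:R = N%:R :> R.
    by rewrite -(rmorph_nat (real_complex R)) normc_real ger0_norm.
  rewrite mulrCA ler_wpM2l // mxE; case: eqP => [->|_].
    rewrite sigma_k1 normc_real mulrN expRN expRM_natr.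
    rewrite lnK ?posrE // -/y rmorph_sum mulrC.
    under eq_bigr do rewrite rmorphM rmorph_int.
    by rewrite (le_trans vC) // ler_pM2r ?invr_gt0 ?exprn_gt0 //; lra.
  rewrite mulr1 lnK ?posrE // rmorph_sum (le_trans (normc_sum _)) //.
  apply: le_trans (_ : \sum_(i < d.+1) Q%:R * normc (sigma k b`_i) <= _).
    apply: ler_sum => i _; rewrite rmorphM rmorph_int normcM ler_wpM2r ?normc_ge0 //.
    rewrite -(rmorph_int (real_complex R)) normc_real -intr_norm.
    by rewrite -natr_absz ler_nat.
  rewrite -mulr_sumr ler_wpM2l //; apply: le_trans (_ : B <= _); last lra.
  rewrite /B [leRHS](bigD1 k) //= lerDl.
  by do 2!apply: sumr_ge0 => ? _; exact: normc_ge0.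
have det_prod : `|ratr (\det (A a)) : R| = expR (\sum_k logemb a 0 k).
  rewrite norm_det_mulmat expR_sum; apply: eq_bigr => k _.
  by rewrite mxE lnK // posrE normc_sigma_gt0.
have detD : \det (A a) = (\det D)%:~R by rewrite DE det_map_mx.
have detD0 : \det D != 0.
  have := mulmat_unit b_basis a0; rewrite unitmxE unitfE detD.
  by rewrite intr_eq0.
have detD_abs : `|ratr (\det (A a)) : R| = `|\det D|%N%:R.
  by rewrite detD ratr_int -intr_norm natr_absz.
have sum_ge0 : 0 <= \sum_k logemb a 0 k.
  by rewrite -[leRHS]expRK ln_ge0 // -det_prod detD_abs ler1n absz_gt0.
have detW : (`|\det D| %| W0`!)%N.
  apply: dvdn_fact; rewrite absz_gt0 detD0 /= ltnW // -(ltr_nat R) -detD_abs det_prod.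
  apply: le_lt_trans (truncnS_gt _); rewrite ler_expR; exact: sum_le up.
exists a; split => //.
- by exists D.
- have /dvdnP[m Dm] := detW.
  have absD : `|\det D|%N%:R = (sgz (\det D) * \det D)%:~R :> rat.
    by rewrite -abszEsg.
  exists ((sgz (\det D) * m%:Z) *: \adj D).
  rewrite mulmatV // /invmx mulmat_unit // scalerA detD DE map_mxZ map_mx_adj.
  congr (_ *: _).
  by rewrite Dm natrM absD !intrM mulrA mulfK ?intr_eq0 // [RHS]intrM mulrC.
- move=> k; rewrite ler_norml; apply/andP; split; last first.
    have := up k; rewrite -lerBlDl => /le_trans; apply.
    by rewrite ler_peMl // ler1n.
  have : \sum_(j | j != k) logemb a 0 j <= \sum_(j | j != k) (ln Q%:R * logdir 0 j + c).
    by apply: ler_sum => j _; exact: up.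
  move: sum_ge0; rewrite (bigD1 k) //= big_split /= -mulr_sumr sumr_const cardC1 card_ord /=.
  have := sum_logdir; rewrite (bigD1 k) //= => /eqP; rewrite addr_eq0 => /eqP ->.
  rewrite -[c *+ d]mulr_natl -[d.+1%:R]natr1 => *; nra.
Qed.

(** Units of the multiplier ring that are positive in the physical embedding:
    multiplication by them permutes the lattice and keeps the order of its
    points on the line. *)
Definition unit_elt (u : L) : Prop :=
  [/\ 0 < iota u, integral_mx (A u) & integral_mx (A u^-1)].

Lemma unit_elt_neq0 u : unit_elt u -> u != 0.
Proof. by case=> u0 _ _; apply: contraTneq u0 => ->; rewrite rmorph0 ltxx. Qed.

Lemma infinitely_often (T : finType) (f : nat -> T) :
  exists c, forall N, exists2 Q, (N <= Q)%N & f Q = c.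
Proof.
apply: contrapT => /forallNP noc.
have /choice[g gP] : forall c, exists N, forall Q, (N <= Q)%N -> f Q <> c.
  move=> c; have /existsNP[N nN] := noc c.
  by exists N => Q NQ fQ; apply: nN; exists Q.
exact: (gP (f (\max_c g c)%N) _ (leq_bigmax _) erefl).
Qed.

(** Among the elements of lemma short_elements infinitely many are congruent modulo
    W; the quotient of two congruent ones a and a' is a unit, since
    a / a' = 1 + (a - a') / a' and W / a' is integral, and symmetrically.
    Dividing by a fixed a' moves the logarithms only by a bounded amount. *)
Lemma units_along_logdir : exists C : R, forall N : nat, exists (Q : nat) (u : L),
  [/\ (N <= Q)%N, unit_elt u & near_logdir C (ln Q%:R) u].
Proof.
have [C [W [W_gt0 short]]] := short_elements.
have [a aP] := choice (fun Q => short Q.+1 isT).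
have /choice[B BE] : forall Q, exists B : 'M[int]_d.+1, A (a Q) = map_mx intr B.
  by move=> Q; case: (aP Q).
have resW m : (`|(m %% W%:Z)%Z|%N < W)%N.
  by have := ltz_mod m (_ : W%:Z != 0); have := modz_ge0 m (_ : W%:Z != 0); lia.
pose f Q := [ffun ij : 'I_d.+1 * 'I_d.+1 => Ordinal (resW (B Q ij.1 ij.2))].
have [c cP] := infinitely_often f.
have [Q1 _ fQ1] := cP 0%N.
have a0 Q : a Q != 0 by case: (aP Q).
have int_div Q Q' : f Q = f Q' -> integral_mx (A (a Q / a Q')).
  move=> ff; have [_ _ [V VE] _] := aP Q'.
  have [X XE] : exists X, B Q = B Q' + W%:Z *: X.
    exists (\matrix_(i, j) ((B Q i j - B Q' i j) %/ W%:Z)%Z).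
    apply/matrixP => i j; rewrite !mxE.
    have /(congr1 val) /= := congr1 (fun g : {ffun _} => g (i, j)) ff.
    rewrite !ffunE /= => e.
    have : (B Q i j = B Q' i j %[mod W%:Z])%Z.
      have := modz_ge0 (B Q i j) (_ : W%:Z != 0).
      by have := modz_ge0 (B Q' i j) (_ : W%:Z != 0); lia.
    move=> /eqP; rewrite eqz_mod_dvd => /divzK; lia.
  have -> : A (a Q / a Q') = 1%:M + map_mx intr X *m map_mx intr V.
    rewrite mulmatM // BE XE map_mxD map_mxZ mulmxDl -BE -mulmatM // divff // mulmat1 //.
    by rewrite -VE -scalemxAl scalemxAr.
  by apply: integral_mxD; [exact: integral_mx1 | apply: integral_mxM; eexists].
exists (C + C + `|ln (Q1.+1%:R : R)| * (d%:R + 1)) => N.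
have [Q NQ fQ] := cP N.
pose u0 := a Q / a Q1.
have u0_neq0 : u0 != 0 by rewrite mulf_neq0 ?invr_eq0.
have Au0 : integral_mx (A u0) by apply: int_div; rewrite fQ.
have Au0V : integral_mx (A u0^-1) by rewrite invf_div; apply: int_div; rewrite fQ.
have near0 : near_logdir (C + C + `|ln (Q1.+1%:R : R)| * (d%:R + 1)) (ln Q.+1%:R) u0.
  move=> k; rewrite /u0 logembM ?invr_eq0 ?a0 // logembV ?a0 //.
  have -> : (logemb (a Q) - logemb (a Q1)) 0 k = logemb (a Q) 0 k - logemb (a Q1) 0 k.
    by rewrite mxE; congr (_ + _); rewrite [LHS]mxE.
  have [_ _ _ /(_ k) h1] := aP Q; have [_ _ _ /(_ k) h2] := aP Q1.
  have h3 : `|ln (Q1.+1%:R : R) * logdir 0 k| <= `|ln (Q1.+1%:R : R)| * (d%:R + 1).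
    rewrite normrM ler_wpM2l // mxE; case: ifP => _.
      by rewrite normrN ger0_norm // lerDl.
    by rewrite normr1 lerDr.
  rewrite (_ : _ - _ = (logemb (a Q) 0 k - ln Q.+1%:R * logdir 0 k)
    - (logemb (a Q1) 0 k - ln Q1.+1%:R * logdir 0 k) - ln Q1.+1%:R * logdir 0 k); last lra.
  rewrite (le_trans (ler_normB _ _)) // lerD // (le_trans (ler_normB _ _)) // lerD //.
have [u0_gt0|u0_le0] := ltP 0 (iota u0).
  by exists Q.+1, u0; split => //; exact: leqW.
exists Q.+1, (- u0); split.
- exact: leqW.
- split; last 2 first.
  + by rewrite linearN; exact: integral_mxN.
  + by rewrite invrN linearN; exact: integral_mxN.
  by rewrite rmorphN oppr_gt0 lt_neqAle u0_le0 fmorph_eq0 u0_neq0.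
- by move=> k; have := near0 k; rewrite !mxE rmorphN normcN.
Qed.

(** The part of Dirichlet's unit theorem that quasiperiodicity rests on.  The
    logarithms of the units span a closed subspace, which contains logdir
    because the units of lemma units_along_logdir have logarithms
    ln Q * logdir + O(1) with ln Q unbounded.  A maximal free family of
    logarithms has at most d + 1 members. *)
Lemma logdir_unit_span : exists (s : nat) (u : 'I_s -> L) (beta : 'rV[R]_s),
  [/\ (s <= d.+1)%N, forall i, unit_elt (u i)
    & logdir = beta *m \matrix_i logemb (u i)].
Proof.
pose P s := `[< exists u : 'I_s -> L, (forall i, unit_elt (u i)) /\
  row_free (\matrix_i logemb (u i)) >].
have exP : exists s, P s.
  exists 0%N; apply/asboolP; exists (fun=> 0); split=> [[]|] //.
  by rewrite /row_free flatmx0 mxrank0.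
have ubP s : P s -> (s <= d.+1)%N.
  by move=> /asboolP[u [_ /eqP <-]]; exact: rank_leq_col.
case: (ex_maxnP exP ubP) => s /asboolP[u [uU ufree]] smax.
have s_le : (s <= d.+1)%N by apply: ubP; apply/asboolP; exists u.
pose M := \matrix_i logemb (u i); rewrite -/M in ufree.
have span v : unit_elt v -> (logemb v <= M)%MS.
  move=> vU; apply: contraT => nvM.
  have rk : (s < \rank (M + logemb v)%MS)%N.
    apply: (@leq_ltn_trans (\rank M)); first by rewrite (eqP ufree).
    rewrite ltn_neqAle mxrankS ?addsmxSl // andbT.
    apply: contra nvM => /eqP rk.
    have /eqmxP/andP[_ sub] : (M :=: M + logemb v)%MS.
      by apply/eqmxP; rewrite -(geq_leqif (mxrank_leqif_eq (addsmxSl _ _))) rk.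
    exact: submx_trans (addsmxSr _ _) sub.
  suff : P (s + 1)%N by move/smax; rewrite addn1 ltnn.
  apply/asboolP; exists (fun i => if fintype.split i is inl j then u j else v); split.
    by move=> i; case: fintype.split.
  rewrite (_ : \matrix_i _ = col_mx M (logemb v)).
    by rewrite /row_free eqn_leq rank_leq_row -addsmxE addn1.
  apply/matrixP => i k; rewrite !mxE; case: splitP => j _; rewrite !mxE //.
suff : (logdir <= M)%MS by case/submxP => beta Dbeta; exists s; exists u; exists beta; split.
rewrite submxE; apply/eqP/rowP => j; rewrite [RHS]mxE.
apply/eqP; apply: contraT => x0; set x := (_ 0 j) in x0.
have [C CP] := units_along_logdir.
pose C' := \sum_k C * `|cokermx M k j|.
pose T := (C' + 1) / `|x|.
have [Q [v [NQ vU nearv]]] := CP (Num.truncn (expR T)).+1.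
have tT : T <= ln Q%:R.
  have Q_ge : expR T <= Q%:R.
    by rewrite (le_trans (ltW (truncnS_gt _))) // ler_nat.
  by rewrite -ler_expR lnK // posrE (lt_le_trans _ Q_ge) ?expR_gt0.
have vK : logemb v *m cokermx M = 0 by apply/eqP; rewrite -submxE span.
(* x is an entry of logdir times the cokernel of M, which kills logarithms of units. *)
have : `|ln Q%:R * x| <= C'.
  have -> : ln Q%:R * x = - ((logemb v - ln Q%:R *: logdir) *m cokermx M) 0 j.
    have negZ (w : 'rV[R]_d.+1) t : t * w 0 j = - (- (t *: w)) 0 j.
      by rewrite !mxE opprK.
    by rewrite negZ mulmxBl vK sub0r -scalemxAl.
  rewrite normrN mxE (le_trans (ler_norm_sum _ _ _)) // ler_sum // => k _.
  by rewrite normrM ler_wpM2r //; have := nearv k; rewrite !mxE.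
rewrite normrM leNgt => /negP[]; rewrite -ltr_pdivrMr ?normr_gt0 //.
rewrite (lt_le_trans _ (le_trans tT (ler_norm _))) // ltr_pM2r ?invr_gt0 ?normr_gt0 //.
by rewrite ltrDl.
Qed.

End Units.

(** * The metric on the torus and the phase of an energy *)
Section TorusMetric.
Variable R : realType.
Implicit Types (p q r : circle R) (x y : R).

Lemma to_circleP x y : to_circle x = to_circle y <-> x - y \is a Num.int.
Proof.
rewrite /to_circle; split=> [/eqP|xy]; last apply/eqP.
  by rewrite -Quotient.idealrBE.
by rewrite -Quotient.idealrBE.
Qed.

Lemma to_circle_surj p : exists x, to_circle x = p.
Proof. by exists (repr p); rewrite /to_circle reprK. Qed.

Lemma circle_dist_has_inf p q :
  has_inf [set z : R | exists x y, [/\ to_circle x = p, to_circle y = q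
                             & z = `|x - y|]].
Proof.
split; last by exists 0 => z [x [y [_ _ ->]]].
have [x xp] := to_circle_surj p; have [y yq] := to_circle_surj q.
by exists `|x - y|, x, y.
Qed.

Lemma circle_dist_le x y : circle_dist (to_circle x) (to_circle y) <= `|x - y|.
Proof.
have [_ lb] := circle_dist_has_inf (to_circle x) (to_circle y).
by apply: ge_inf => //; exists x, y.
Qed.

Lemma le_circle_dist c p q :
  (forall x y, to_circle x = p -> to_circle y = q -> c <= `|x - y|) ->
  c <= circle_dist p q.
Proof.
move=> h; apply: lb_le_inf; first by case: (circle_dist_has_inf p q).
by move=> z [x [y [xp yq ->]]]; exact: h.
Qed.

Lemma circle_dist_ge0 p q : 0 <= circle_dist p q.
Proof. exact: le_circle_dist. Qed.

Lemma circle_distxx p : circle_dist p p = 0.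
Proof.
apply/eqP; rewrite eq_le circle_dist_ge0 andbT.
by have [x <-] := to_circle_surj p; rewrite -[leRHS](normr0 R) -(subrr x) circle_dist_le.
Qed.

Lemma circle_dist_sym p q : circle_dist p q <= circle_dist q p.
Proof.
apply: le_circle_dist => x y <- <-.
by rewrite distrC circle_dist_le.
Qed.

(** Representatives of q in the two infima differ by an integer, which can be moved
    to the representative of r. *)
Lemma circle_dist_triangle p q r :
  circle_dist p r <= circle_dist p q + circle_dist q r.
Proof.
rewrite -lerBlDr; apply: le_circle_dist => x y <- yq.
rewrite lerBlDr addrC -lerBlDr; apply: le_circle_dist => y' z yq' <-.
rewrite lerBlDr addrC.
have /to_circleP yy : to_circle y' = to_circle y by rewrite yq'.
have -> : to_circle z = to_circle (z - (y' - y)).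
  by apply/to_circleP; rewrite opprB addrC subrK.
apply: le_trans (circle_dist_le _ _) _.
rewrite (_ : x - _ = (x - y) + (y' - z)); last ring.
exact: ler_normD.
Qed.

Section Torus.
Variable k : nat.
Implicit Types u v w : 'rV[circle R]_k.

Lemma torus_dist_ge0 u v : 0 <= torus_dist u v.
Proof.
rewrite /torus_dist; elim/big_ind: _ => // [x y x0 y0|i _]; last exact: circle_dist_ge0.
by rewrite le_max x0.
Qed.

Lemma circle_dist_le_torus u v i : circle_dist (u 0 i) (v 0 i) <= torus_dist u v.
Proof. by rewrite /torus_dist (bigD1 i) //= le_max lexx. Qed.

Lemma torus_dist_le c u v : 0 <= c ->
  (forall i, circle_dist (u 0 i) (v 0 i) <= c) -> torus_dist u v <= c.
Proof.
move=> c0 h; rewrite /torus_dist; elim/big_ind: _ => // x y xc yc.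
by rewrite ge_max xc.
Qed.

Lemma torus_distxx u : torus_dist u u = 0.
Proof.
by apply/eqP; rewrite eq_le torus_dist_ge0 andbT torus_dist_le // => i; rewrite circle_distxx.
Qed.

Lemma torus_dist_sym u v : torus_dist u v <= torus_dist v u.
Proof.
apply: torus_dist_le (torus_dist_ge0 _ _) _ => i.
exact: le_trans (circle_dist_sym _ _) (circle_dist_le_torus _ _ _).
Qed.

Lemma torus_dist_triangle u v w :
  torus_dist u w <= torus_dist u v + torus_dist v w.
Proof.
apply: torus_dist_le; first by rewrite addr_ge0 ?torus_dist_ge0.
move=> i; apply: le_trans (circle_dist_triangle _ (v 0 i) _) _.
by apply: lerD; exact: circle_dist_le_torus.
Qed.
End Torus.

Lemma row_entry_le_norm (k : nat) (v : 'rV[R]_k) i : `|v 0 i| <= `|v|.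
Proof.
rewrite [leRHS]mx_normrE (bigD1 (0, i)) //= le_max lexx //.
Qed.

Lemma row_norm_le (k : nat) (v : 'rV[R]_k) c :
  0 <= c -> (forall i, `|v 0 i| <= c) -> `|v| <= c.
Proof.
move=> c0 h; rewrite [leLHS]mx_normrE; elim/big_ind: _ => // [x y xc yc|[i j] _].
  by rewrite ge_max xc.
by rewrite /= ord1.
Qed.

Lemma frac_itv x : 0 <= frac x < 1.
Proof. by rewrite /frac subr_ge0 ltrBlDl floor_le_tmp ?num_real //= -intrD1 floorD1_gt. Qed.

(** The distance, on the product of the torus and the cube, between the two
    points at which the function h of the theorem is evaluated. *)
Definition phase_dist (k s : nat) (theta : 'rV[R]_k) (beta : 'rV[R]_s) (E E' : R) : R :=
  torus_dist (to_torus (ln E *: theta)) (to_torus (ln E' *: theta))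
  + `|map_mx frac (ln E *: beta) - map_mx frac (ln E' *: beta)|.

Lemma phase_dist_ge0 (k s : nat) (theta : 'rV[R]_k) (beta : 'rV[R]_s) (E E' : R) :
  0 <= phase_dist theta beta E E'.
Proof. by rewrite addr_ge0 // torus_dist_ge0. Qed.

End TorusMetric.

(** * Polar coordinates in the complex plane *)
Section Polar.
Variable R : realType.
Implicit Types x y a l : R.

(** By the mean value theorem. *)
Lemma lipschitz1_of_derive (f df : R -> R) :
  (forall x, is_derive x 1 f (df x)) -> (forall x, `|df x| <= 1) ->
  forall x y, `|f x - f y| <= `|x - y|.
Proof.
move=> fdf df1 x y; wlog xy : x y / x <= y.
  by move=> wl; have [/wl//|/ltW/wl] := leP x y; rewrite distrC [leRHS]distrC.
have fc z : {for z, continuous f}.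
  by apply: differentiable_continuous; apply/derivable1_diffP; exact: ex_derive.
have [|c _ e] := @MVT_segment R f df x y xy (fun z _ => fdf z).
  by apply: continuous_subspaceT => z; exact: fc.
by rewrite distrC e normrM [leRHS]distrC ler_piMl.
Qed.

Lemma cos_lipschitz x y : `|cos x - cos y| <= `|x - y|.
Proof.
by apply: (@lipschitz1_of_derive _ (fun z => - sin z)) => z; rewrite normrN sin_max.
Qed.

Lemma sin_lipschitz x y : `|sin x - sin y| <= `|x - y|.
Proof. by apply: (@lipschitz1_of_derive _ cos) => z; rewrite ?cos_max. Qed.

Definition polar l a : R[i] := (expR l)%:C%C * (cos a +i* sin a)%C.

Lemma polarD l a l' a' : polar (l + l') (a + a') = polar l a * polar l' a'.
Proof.
rewrite /polar expRD rmorphM /= mulrACA; congr (_ * _).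
by rewrite cosD sinD; simpc; congr (_ +i* _)%C; ring.
Qed.

Lemma polar0 : polar 0 0 = 1.
Proof. by rewrite /polar expR0 cos0 sin0 mul1r. Qed.

Lemma polar_sum (I : finType) (l a : I -> R) :
  polar (\sum_i l i) (\sum_i a i) = \prod_i polar (l i) (a i).
Proof.
elim/big_rec3: _ => [|i z w u _ <-]; first exact: polar0.
by rewrite polarD.
Qed.

Lemma polarN l a : polar (- l) (- a) = (polar l a)^-1.
Proof. by apply: invr_inj; rewrite invrK; apply: mulr1_eq; rewrite -polarD !addNr polar0. Qed.

Lemma polarMn l a (n : nat) : polar (l *+ n) (a *+ n) = polar l a ^+ n.
Proof. by elim: n => [|n IH]; rewrite ?mulr0n ?polar0 // !mulrS polarD IH exprS. Qed.

Lemma polarXz l a (q : int) : polar (q%:~R * l) (q%:~R * a) = polar l a ^ q.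
Proof.
rewrite !mulrzl; case: q => n; first exact: polarMn.
by rewrite !NegzE !mulrNz polarN polarMn exprnN.
Qed.

Lemma normc_polar l a : normc (polar l a) = expR l.
Proof.
rewrite normcM normc_real ger0_norm ?expR_ge0 //.
by rewrite /= cos2Dsin2 sqrtr1 mulr1.
Qed.

(** The arc cosine of the real part of z / |z| is the angle up to sign. *)
Lemma polar_exists (z : R[i]) : z != 0 -> exists a, z = polar (ln (normc z)) a.
Proof.
move=> z0; have m_gt0 := normc_gt0 z0.
pose w := z / (normc z)%:C%C.
have w1 : normc w = 1.
  by rewrite normcM normcV normc_real ger0_norm ?normc_ge0 // divff // gt_eqF.
have Dz : z = (normc z)%:C%C * w.
  by rewrite mulrC divfK // fmorph_eq0 gt_eqF.
suff [a wa] : exists a, w = (cos a +i* sin a)%C.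
  by exists a; rewrite {1}Dz wa /polar lnK ?posrE.
case: w w1 {Dz} => x y /= xy.
have {xy} xy : x ^+ 2 + y ^+ 2 = 1.
  by rewrite -[LHS]sqr_sqrtr ?xy ?expr1n // addr_ge0 ?sqr_ge0.
have x1 : -1 <= x <= 1 by apply/andP; split; nra.
have y2 : Num.sqrt (1 - x ^+ 2) = `|y| by rewrite -xy addrC addKr sqrtr_sqr.
have [y0|y0] := leP 0 y.
  by exists (acos x); rewrite sin_acos // acosK ?in_itv // y2 ger0_norm.
by exists (- acos x); rewrite cosN sinN sin_acos // acosK ?in_itv // y2 ltr0_norm ?opprK.
Qed.

Lemma expR_lipschitz M x y : x <= M -> y <= M -> `|expR x - expR y| <= expR M * `|x - y|.
Proof.
wlog xy : x y / x <= y.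
  by move=> wl xM yM; have [/wl->//|/ltW/wl] := leP x y; rewrite distrC (distrC x y) => ->.
move=> _ yM; rewrite distrC (distrC x y) !ger0_norm ?subr_ge0 ?ler_expR //.
apply: le_trans (_ : expR y * (y - x) <= _); last by rewrite ler_wpM2r ?subr_ge0 ?ler_expR.
have -> : expR x = expR y * expR (x - y) by rewrite -expRD addrC subrK.
have := expR_ge1Dx (x - y); have := expR_gt0 y; nra.
Qed.

Lemma normc_leD x y : normc (x +i* y)%C <= `|x| + `|y|.
Proof.
rewrite /= -[leRHS]ger0_norm ?addr_ge0 // -sqrtr_sqr ler_wsqrtr //.
rewrite -(real_normK (num_real x)) -(real_normK (num_real y)).
by have := normr_ge0 x; have := normr_ge0 y; nra.
Qed.

Lemma polar_lipschitz M l a l' a' : l <= M -> l' <= M ->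
  normc (polar l a - polar l' a') <= expR M * (`|l - l'| + 2 * `|a - a'|).
Proof.
move=> lM lM'.
have -> : polar l a - polar l' a' =
    (expR l - expR l')%:C%C * (cos a +i* sin a)%C
    + (expR l')%:C%C * ((cos a - cos a') +i* (sin a - sin a'))%C.
  by rewrite /polar; simpc; congr (_ +i* _)%C; ring.
rewrite (le_trans (le_normcD _ _)) // mulrDr lerD // normcM normc_real.
  by rewrite [normc _](_ : _ = 1) ?mulr1 ?expR_lipschitz //= cos2Dsin2 sqrtr1.
rewrite ger0_norm ?expR_ge0 // ler_pM ?expR_ge0 ?normc_ge0 ?ler_expR //.
rewrite (le_trans (normc_leD _ _)) //.
by have := cos_lipschitz a a'; have := sin_lipschitz a a'; lra.
Qed.

Lemma polar_periodic l a (m : int) : polar l (a + m%:~R * (2 * pi)) = polar l a.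
Proof.
have -> : l = l + m%:~R * 0 by rewrite mulr0 addr0.
rewrite polarD polarXz /polar expR0 mul1r mulr_natl cos2pi sin2pi.
by rewrite (_ : (1 +i* 0)%C = 1) // exp1rz mulr1 mulr0 addr0.
Qed.

(** Angles that are integer multiples of 2 pi apart give the same point, so that the
    bound for representatives descends to the distance on the circle. *)
Lemma polar_circle_lipschitz M l a l' a' x x' : l <= M -> l' <= M ->
  normc (polar l (2 * pi * x + a) - polar l' (2 * pi * x' + a')) <=
    expR M * (`|l - l'| + 2 * `|a - a'| + 4 * pi * circle_dist (to_circle x) (to_circle x')).
Proof.
move=> lM lM'; have pi0 := pi_gt0 R.
set N := normc _; pose t := (N / expR M - `|l - l'| - 2 * `|a - a'|) / (4 * pi).
have e0 := expR_gt0 M.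
suff le : t <= circle_dist (to_circle x) (to_circle x').
  have : N / expR M <= `|l - l'| + 2 * `|a - a'|
      + 4 * pi * circle_dist (to_circle x) (to_circle x').
    by move: le; rewrite /t ler_pdivrMr ?mulr_gt0 //; lra.
  by rewrite ler_pdivrMr // mulrC.
apply: le_circle_dist => z z' /to_circleP/intrP[m Dm] /to_circleP/intrP[m' Dm'].
rewrite /t ler_pdivrMr ?mulr_gt0 //.
suff : N / expR M <= `|l - l'| + 2 * (`|2 * pi * (z - z')| + `|a - a'|).
  by rewrite !normrM (ger0_norm (pi_ge0 R)) (ger0_norm (ler0n R 2)); lra.
rewrite ler_pdivrMr // mulrC /N.
have -> : polar l (2 * pi * x + a) = polar l (2 * pi * z + a).
  by rewrite -[RHS](polar_periodic _ _ (- m)); congr polar; rewrite mulrNz -Dm; ring.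
have -> : polar l' (2 * pi * x' + a') = polar l' (2 * pi * z' + a').
  by rewrite -[RHS](polar_periodic _ _ (- m')); congr polar; rewrite mulrNz -Dm'; ring.
apply: le_trans (polar_lipschitz _ _ lM lM') _.
rewrite ler_pM2l // lerD2l ler_pM2l //.
by rewrite (_ : _ - _ = 2 * pi * (z - z') + (a - a')) ?ler_normD //; ring.
Qed.

End Polar.

(** * Renormalization by units *)
(** What a unit u of size about E^-d in the physical embedding and E in the other
    ones does to the lattice of integer vectors: U and V are the matrices of
    multiplication by u and by its inverse, b lists the physical coordinates of
    the basis and lam is u itself.  The last field says that V brings a vector
    of size X with a small value of the linear form back to bounded size when X
    is of order E and the form is of order E^-d. *)
Record renormalizes (R : realType) (d : nat) (b : 'I_d.+1 -> R) (C E lam : R)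
    (U V : 'M[int]_d.+1) : Prop := Renormalizes {
  renorm_inv : U *m V = 1%:M;
  renorm_eigen : forall i, \sum_j (U i j)%:~R * b j = lam * b i;
  renorm_gt0 : 0 < lam;
  renorm_le : lam * E ^+ d <= C;
  renorm_ge : 1 <= C * (lam * E ^+ d);
  renorm_expand : forall i j, `|(U i j)%:~R| <= C * (E + E ^- d);
  renorm_contract : forall (x : 'I_d.+1 -> R) (X : R), (forall i, `|x i| <= X) ->
    forall j, `|\sum_i x i * (V i j)%:~R| <= C * (X / E + `|\sum_i x i * b i| * E ^+ d)
}.

Section Flow.
Variables (R : realType) (L : fieldExtType rat) (d : nat) (b : d.+1.-tuple L).
Hypothesis b_basis : basis_of fullv b.
Variables (iota : {rmorphism L -> R}) (sigma : 'I_d.+1 -> {rmorphism L -> R[i]}).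
Variable k1 : 'I_d.+1.
Hypothesis sigma_k1 : forall x, sigma k1 x = (iota x)%:C%C.
Local Notation S := (embmx b sigma).
Local Notation S' := (invmx (embmx b sigma)).
Hypothesis embmx_unit : S \in unitmx.
Local Notation A := (mulmat b).

(** Diagonalization of multiplication: sizes of entries are read off the sizes of the
    conjugates of x. *)
Lemma int_mulmat_entry x (B : 'M[int]_d.+1) i j : A x = map_mx intr B ->
  (B i j)%:~R = \sum_k S i k * sigma k x * S' k j.
Proof.
move=> AB; have := congr1 (fun M => (M *m S') i j) (mulmat_sigma b_basis sigma x).
rewrite /= mulmxK // AB !mxE rmorph_int => ->; apply: eq_bigr => k _.
by rewrite mul_mx_diag !mxE.
Qed.

Lemma normc_int (m : int) : normc (m%:~R : R[i]) = `|m%:~R : R|.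
Proof. by rewrite -(rmorph_int (real_complex R)) normc_real. Qed.

Lemma unit_eltM u v : unit_elt b iota u -> unit_elt b iota v -> unit_elt b iota (u * v).
Proof.
move=> [u0 Au Au'] [v0 Av Av']; split; first by rewrite rmorphM mulr_gt0.
  by rewrite mulmatM //; exact: integral_mxM.
by rewrite invfM mulmatM //; exact: integral_mxM.
Qed.

Lemma unit_elt1 : unit_elt b iota 1.
Proof.
split; first by rewrite rmorph1 ltr01.
  by rewrite mulmat1 //; exact: integral_mx1.
by rewrite invr1 mulmat1 //; exact: integral_mx1.
Qed.

Lemma unit_eltV u : unit_elt b iota u -> unit_elt b iota u^-1.
Proof. by move=> [u0 Au Au']; split; rewrite ?invrK // fmorphV invr_gt0. Qed.

Lemma unit_eltX u (q : int) : unit_elt b iota u -> unit_elt b iota (u ^ q).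
Proof.
move=> uU; have powU n : unit_elt b iota (u ^+ n).
  by elim: n => [|n IH]; [exact: unit_elt1 | rewrite exprS; exact: unit_eltM].
case: q => n; first exact: powU.
by rewrite NegzE -exprnN; exact: unit_eltV.
Qed.

(** The expected size of the conjugate at the place k of the unit used at scale E. *)
Definition weight (E : R) (k : 'I_d.+1) : R := if k == k1 then E ^- d else E.

Lemma weight_gt0 E k : 0 < E -> 0 < weight E k.
Proof. by move=> E0; rewrite /weight; case: ifP => _; rewrite ?invr_gt0 ?exprn_gt0. Qed.

Lemma weightE E k : 0 < E -> weight E k = expR (ln E * logdir R k1 0 k).
Proof.
move=> E0; rewrite /weight mxE; case: ifP => _; last by rewrite mulr1 lnK.
by rewrite mulrN expRN expRM_natr lnK.
Qed.

Lemma near_logdir_weight C E u k : 0 < E -> u != 0 -> near_logdir sigma k1 C (ln E) u ->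
  normc (sigma k u) <= expR C * weight E k /\ weight E k <= expR C * normc (sigma k u).
Proof.
move=> E0 u0 /(_ k); rewrite mxE => nr.
have e : normc (sigma k u) = expR (ln (normc (sigma k u))).
  by rewrite lnK // posrE normc_sigma_gt0.
by rewrite e weightE // -!expRD !ler_expR; move: nr; rewrite ler_norml => /andP[]; lra.
Qed.

Let B1 := \sum_i \sum_j \sum_k normc (S i k * S' k j).
Let B2 := \sum_i \sum_j \sum_k normc (S i k) * normc (S' k j).
Let B3 := \sum_j \sum_k normc (S' k j).

Lemma le_sum_term (I : finType) (F : I -> R) i : (forall i, 0 <= F i) -> F i <= \sum_i F i.
Proof. by move=> F0; rewrite [leRHS](bigD1 i) //= lerDl sumr_ge0. Qed.

Lemma unit_renormalizes C E u : 0 < E -> unit_elt b iota u ->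
    near_logdir sigma k1 C (ln E) u ->
  forall U V, A u = map_mx intr U -> A u^-1 = map_mx intr V ->
  renormalizes (fun i => iota b`_i) (expR C * (1 + B1 + B2 + B3)) E (iota u) U V.
Proof.
move=> E0 uU nr U V AU AV; have u0 := unit_elt_neq0 uU; have [iu_gt0 _ _] := uU.
have Ed0 : 0 < E ^+ d by rewrite exprn_gt0.
have eC0 := expR_gt0 C.
have B1_ge0 : 0 <= B1 by do 3!apply: sumr_ge0 => ? _; exact: normc_ge0.
have B2_ge0 : 0 <= B2 by do 3!apply: sumr_ge0 => ? _; rewrite mulr_ge0 ?normc_ge0.
have B3_ge0 : 0 <= B3 by do 2!apply: sumr_ge0 => ? _; exact: normc_ge0.
have wt k := near_logdir_weight k E0 u0 nr.
have [w1 w1'] := wt k1.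
have iuE : normc (sigma k1 u) = iota u by rewrite sigma_k1 normc_real gtr0_norm.
rewrite iuE /weight eqxx in w1 w1'.
have iotaE : iota u * E ^+ d <= expR C by rewrite -ler_pdivlMr.
have iotaE' : 1 <= expR C * (iota u * E ^+ d).
  by rewrite mulrA -ler_pdivrMr // mul1r.
split.
- have /matrixP UV : map_mx (intr : int -> rat) (U *m V) = map_mx intr 1%:M.
    by rewrite map_mxM -AU -AV -mulmatM // divff // mulmat1 // map_mx1.
  by apply/matrixP => i j; have := UV i j; rewrite !mxE => /intr_inj.
- move=> i; rewrite mulrC -rmorphM mulmatE // [RHS]rmorph_sum; apply: eq_bigr => j _.
  by rewrite AU mxE scaler_int rmorphMz mulrzl.
- exact: iu_gt0.
- by apply: le_trans iotaE _; rewrite ler_peMr ?expR_ge0 //; lra.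
- by apply: le_trans iotaE' _; rewrite ler_pM2r ?mulr_gt0 // ler_peMr ?expR_ge0 //; lra.
- move=> i j; rewrite -normc_int (int_mulmat_entry _ _ AU).
  have wE k : weight E k <= E + E ^- d.
    by rewrite /weight; case: ifP => _; rewrite ?lerDl ?lerDr ?invr_ge0 ltW.
  apply: (le_trans (normc_sum _)).
  apply: (@le_trans _ _ (\sum_k normc (S i k * S' k j) * (expR C * (E + E ^- d)))).
    apply: ler_sum => k _; rewrite mulrAC normcM ler_wpM2l ?normc_ge0 //.
    by apply: le_trans (wt k).1 _; rewrite ler_pM2l.
  rewrite -mulr_suml mulrCA mulrA ler_pM2r ?addr_gt0 ?invr_gt0 // ler_pM2l //.
  apply: (@le_trans _ _ B1); last lra.
  apply: (@le_trans _ _ (\sum_j \sum_k normc (S i k * S' k j))).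
    apply: (@le_sum_term _ (fun j => \sum_k normc (S i k * S' k j))) => ?.
    by apply: sumr_ge0 => ? _; exact: normc_ge0.
  apply: (@le_sum_term _ (fun i => \sum_j \sum_k normc (S i k * S' k j))) => ?.
  by do 2!apply: sumr_ge0 => ? _; exact: normc_ge0.
- move=> x X xX j.
  have X_ge0 : 0 <= X by exact: le_trans (normr_ge0 _) (xX 0).
  set ell := \sum_i x i * iota b`_i.
  rewrite -normc_real rmorph_sum /=.
  have -> : \sum_i (x i * (V i j)%:~R)%:C%C =
      \sum_k (\sum_i (x i)%:C%C * S i k) * (sigma k u^-1 * S' k j).
    under [RHS]eq_bigr do rewrite mulr_suml.
    rewrite exchange_big /=; apply: eq_bigr => i _.
    rewrite rmorphM rmorph_int (int_mulmat_entry _ _ AV) mulr_sumr.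
    by apply: eq_bigr => k _; rewrite !mulrA.
  apply: (le_trans (normc_sum _)).
  have inv_wt k : normc (sigma k u^-1) <= expR C / weight E k.
    rewrite fmorphV normcV ler_pdivlMr ?weight_gt0 // mulrC ler_pdivrMr ?normc_sigma_gt0 //.
    exact: (wt k).2.
  have tk k : normc ((\sum_i (x i)%:C%C * S i k) * (sigma k u^-1 * S' k j)) <=
     (expR C * (X / E)) * (\sum_i normc (S i k) * normc (S' k j))
     + (expR C * (`|ell| * E ^+ d)) * normc (S' k j).
    have [->|kk1] := eqVneq k k1.
      rewrite -[leLHS]add0r lerD //.
        rewrite mulr_ge0 ?mulr_ge0 ?expR_ge0 ?invr_ge0 ?(ltW E0) //.
        by apply: sumr_ge0 => i _; rewrite mulr_ge0 ?normc_ge0.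
      have -> : \sum_i (x i)%:C%C * S i k1 = ell%:C%C.
        by rewrite rmorph_sum; apply: eq_bigr => i _; rewrite rmorphM mxE sigma_k1.
      rewrite !normcM normc_real mulrA ler_wpM2r ?normc_ge0 // mulrCA ler_wpM2l //.
      by have := inv_wt k1; rewrite /weight eqxx invrK.
    rewrite -[leLHS]addr0 lerD //; last by rewrite !mulr_ge0 ?expR_ge0 ?normc_ge0 ?(ltW Ed0).
    rewrite !normcM -mulr_suml [expR C * _]mulrCA -!mulrA [X in _ <= X]mulrCA.
    rewrite [_ * (_ * (_ * _))](_ : _ = (X * \sum_i normc (S i k))
      * (expR C / E * normc (S' k j))); last by ring.
    apply: ler_pM; rewrite ?mulr_ge0 ?normc_ge0 //.
      apply: (le_trans (normc_sum _)); rewrite mulr_sumr; apply: ler_sum => i _.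
      by rewrite normcM normc_real ler_wpM2r ?normc_ge0.
    rewrite ler_wpM2r ?normc_ge0 //.
    by have := inv_wt k; rewrite /weight (negPf kk1).
  apply: le_trans (ler_sum _ (fun k _ => tk k)) _.
  rewrite big_split /= -!mulr_sumr.
  have b2 : \sum_k \sum_i normc (S i k) * normc (S' k j) <= B2.
    rewrite exchange_big /= /B2; apply: ler_sum => i _.
    apply: (@le_sum_term _ (fun j => \sum_k normc (S i k) * normc (S' k j))) => ?.
    by apply: sumr_ge0 => ? _; rewrite mulr_ge0 ?normc_ge0.
  have b3 : \sum_k normc (S' k j) <= B3.
    apply: (@le_sum_term _ (fun j => \sum_k normc (S' k j))) => ?.
    by apply: sumr_ge0 => ? _; exact: normc_ge0.
  rewrite -!(mulrA (expR C)) -mulrDr ler_pM2l // mulrDr; apply: lerD.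
    rewrite mulrC ler_wpM2r ?divr_ge0 ?(ltW E0) //; lra.
  rewrite mulrC ler_wpM2r ?mulr_ge0 ?(ltW Ed0) //; lra.
Qed.

(** Here g is the conjugate at a place k other than k1 of the unit used at
    scale E, divided by E; it depends on the phase of E only. *)
Lemma flow_lipschitz (s : nat) (theta : 'rV[R]_d.+1) (beta : 'rV[R]_s) M
    (l a : 'I_s -> R) k (E E' : R) :
  \sum_i `|l i| <= M -> \sum_i `|a i| <= M ->
  let f E i := frac (ln E * beta 0 i) in
  let g E := polar (- \sum_i f E i * l i)
                   (2 * pi * (ln E * theta 0 k) + - \sum_i f E i * a i) in
  (normc (g E - g E') <= expR M * (3 * M + 4 * pi) * phase_dist theta beta E E' : Prop).
Proof.
move=> lM aM f g.
have M_ge0 : 0 <= M by apply: le_trans lM; apply: sumr_ge0 => i _.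
have f01 E0 i : 0 <= f E0 i <= 1 by have /andP[-> /ltW->] := frac_itv (ln E0 * beta 0 i).
have fle E0 : - (\sum_i f E0 i * l i) <= M.
  apply: le_trans (ler_norm _) _; rewrite normrN; apply: (le_trans (ler_norm_sum _ _ _)).
  apply: le_trans lM; apply: ler_sum => i _; have /andP[f0 f1] := f01 E0 i.
  by rewrite normrM ger0_norm // ler_piMl.
set D := phase_dist _ _ _ _.
have D_tor : circle_dist (to_circle (ln E * theta 0 k)) (to_circle (ln E' * theta 0 k)) <= D.
  have := circle_dist_le_torus (to_torus (ln E *: theta)) (to_torus (ln E' *: theta)) k.
  by rewrite !mxE /D /phase_dist => /le_trans; apply; rewrite lerDl.
have D_frac i : `|f E i - f E' i| <= D.
  have := row_entry_le_norm (map_mx frac (ln E *: beta) - map_mx frac (ln E' *: beta)) i.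
  by rewrite !mxE /D /phase_dist => /le_trans; apply; rewrite lerDr torus_dist_ge0.
have D_ge0 : 0 <= D by exact: phase_dist_ge0.
have diff_le (c : 'I_s -> R) : \sum_i `|c i| <= M ->
    `|- (\sum_i f E i * c i) - - (\sum_i f E' i * c i)| <= M * D.
  move=> cM; rewrite opprK addrC -sumrB; apply: (le_trans (ler_norm_sum _ _ _)).
  apply: (@le_trans _ _ (\sum_i `|c i| * D)); last by rewrite -mulr_suml ler_wpM2r.
  apply: ler_sum => i _; rewrite -mulrBl normrM mulrC ler_wpM2l //.
  by rewrite distrC; exact: D_frac.
apply: (le_trans (polar_circle_lipschitz _ _ _ _ (fle E) (fle E'))).
rewrite -(mulrA (expR M)) ler_pM2l ?expR_gt0 //.
have h1 := diff_le l lM; have h2 := diff_le a aM.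
have h3 : 4 * pi * circle_dist (to_circle (ln E * theta 0 k)) (to_circle (ln E' * theta 0 k))
    <= 4 * pi * D.
  by rewrite ler_pM2l ?mulr_gt0 ?pi_gt0.
by move: h1 h2 h3; nra.
Qed.

(** At scale E the unit is the product of the u i to the powers
    floor (ln E * beta i), where beta are the coordinates of logdir in the
    logarithms of the u i.  Its logarithm is ln E * logdir up to the contribution
    of the fractional parts, and its argument at the place k is
    2 pi ln E * theta k up to a similar contribution.  At the place k1 the
    conjugate divided by E is O(E^-1), hence needs no phase. *)
Lemma renormalization_sigma : exists (s : nat) (theta : 'rV[R]_d.+1) (beta : 'rV[R]_s)
    (C : R) (lam : R -> R) (U V : R -> 'M[int]_d.+1),
  [/\ (s <= d.+1)%N, 0 < C,
    forall E, 0 < E -> renormalizes (fun i => iota b`_i) C E (lam E) (U E) (V E)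
    & forall E E' i j, 1 <= E -> 1 <= E' ->
      `|(U E i j)%:~R / E - (U E' i j)%:~R / E'| <=
        C * (phase_dist theta beta E E' + E^-1 + E'^-1)].
Proof.
have [s [u [beta [s_le uU Dbeta]]]] := logdir_unit_span b_basis sigma_k1 embmx_unit.
have u0 i : u i != 0 := unit_elt_neq0 (uU i).
pose l i k := logemb sigma (u i) 0 k.
have /choice[a aP] : forall ik : 'I_s * 'I_d.+1, exists a,
    sigma ik.2 (u ik.1) = polar (l ik.1 ik.2) a.
  move=> [i k] /=; have [|a za] := @polar_exists R (sigma k (u i)); first by rewrite fmorph_eq0 u0.
  by exists a; rewrite {1}za /l mxE.
pose q E i := Num.floor (ln E * beta 0 i).
pose x E := \prod_i u i ^ q E i.
have xU E : unit_elt b iota (x E).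
  apply: (big_ind (unit_elt b iota)); [exact: unit_elt1 | exact: unit_eltM |].
  by move=> i _; exact: unit_eltX.
have sig_x E k : sigma k (x E) =
    polar (\sum_i (q E i)%:~R * l i k) (\sum_i (q E i)%:~R * a (i, k)).
  rewrite rmorph_prod polar_sum; apply: eq_bigr => i _.
  by rewrite fmorphXz polarXz (aP (i, k)).
pose f E i := frac (ln E * beta 0 i).
have qE E i : (q E i)%:~R = ln E * beta 0 i - f E i by rewrite /f /frac opprB addrC subrK.
have dirE k : logdir R k1 0 k = \sum_i beta 0 i * l i k.
  by rewrite Dbeta mxE; apply: eq_bigr => i _; rewrite [in LHS]mxE.
have log_x E k : logemb sigma (x E) 0 k = ln E * logdir R k1 0 k - \sum_i f E i * l i k.
  rewrite mxE sig_x normc_polar expRK dirE mulr_sumr -sumrB; apply: eq_bigr => i _.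
  by rewrite qE mulrBl mulrA.
pose M := \sum_k \sum_i (`|l i k| + `|a (i, k)|).
have M_ge k : \sum_i (`|l i k| + `|a (i, k)|) <= M.
  apply: (@le_sum_term _ (fun k => \sum_i (`|l i k| + `|a (i, k)|))) => ?.
  by apply: sumr_ge0 => ? _; rewrite addr_ge0.
have lM k : \sum_i `|l i k| <= M.
  by apply: le_trans (M_ge k); apply: ler_sum => i _; rewrite lerDl.
have aM k : \sum_i `|a (i, k)| <= M.
  by apply: le_trans (M_ge k); apply: ler_sum => i _; rewrite lerDr.
have M_ge0 : 0 <= M by do 2!apply: sumr_ge0 => ? _; rewrite addr_ge0.
have near_x E : near_logdir sigma k1 M (ln E) (x E).
  move=> k; rewrite log_x addrC addKr normrN; apply: (le_trans (ler_norm_sum _ _ _)).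
  apply: le_trans (lM k); apply: ler_sum => i _.
  have /andP[f0 /ltW f1] := frac_itv (ln E * beta 0 i).
  by rewrite normrM ger0_norm // ler_piMl.
have /choice[U UE] : forall E, exists U, mulmat b (x E) = map_mx intr U.
  by move=> E; case: (xU E).
have /choice[V VE] : forall E, exists V, mulmat b (x E)^-1 = map_mx intr V.
  by move=> E; case: (xU E).
pose theta : 'rV[R]_d.+1 := \row_k ((\sum_i beta 0 i * a (i, k)) / (2 * pi)).
pose C0 := expR M * (1 + B1 + B2 + B3).
pose K := expR M * (3 * M + 4 * pi) + expR M.
have B1_ge0 : 0 <= B1 by do 3!apply: sumr_ge0 => ? _; exact: normc_ge0.
have B2_ge0 : 0 <= B2 by do 3!apply: sumr_ge0 => ? _; rewrite mulr_ge0 ?normc_ge0.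
have B3_ge0 : 0 <= B3 by do 2!apply: sumr_ge0 => ? _; exact: normc_ge0.
have pi0 := pi_gt0 R; have eM0 := expR_gt0 M.
have K_ge0 : 0 <= K by rewrite addr_ge0 ?mulr_ge0 ?addr_ge0 ?mulr_ge0 // ltW.
have C0_gt0 : 0 < C0 by rewrite mulr_gt0 //; lra.
have g_lip E E' k : 1 <= E -> 1 <= E' ->
    normc (sigma k (x E) / E%:C%C - sigma k (x E') / E'%:C%C) <=
      K * (phase_dist theta beta E E' + E^-1 + E'^-1).
  move=> E1 E1'; have E0 : 0 < E by exact: lt_le_trans E1.
  have E0' : 0 < E' by exact: lt_le_trans E1'.
  have D_ge0 := phase_dist_ge0 theta beta E E'.
  have iE : 0 < E^-1 by rewrite invr_gt0.
  have iE' : 0 < E'^-1 by rewrite invr_gt0.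
  have [->|kk1] := eqVneq k k1.
    have bnd (F : R) : 1 <= F -> normc (sigma k1 (x F) / F%:C%C) <= expR M * F^-1.
      move=> F1; have F0 : 0 < F by exact: lt_le_trans F1.
      rewrite normcM normcV normc_real gtr0_norm // ler_pM2r ?invr_gt0 //.
      have [h _] := near_logdir_weight k1 F0 (unit_elt_neq0 (xU F)) (near_x F).
      apply: le_trans h _; rewrite ger_pMr // /weight eqxx invf_le1 ?exprn_gt0 //.
      exact: exprn_ege1.
    apply: (le_trans (le_normcD _ _)); rewrite normcN.
    have h := bnd E E1; have h' := bnd E' E1'; rewrite /K.
    apply: le_trans (lerD h h') _; rewrite -mulrDr.
    apply: le_trans (_ : expR M * (phase_dist theta beta E E' + E^-1 + E'^-1) <= _).
      by rewrite ler_pM2l //; lra.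
    rewrite ler_wpM2r ?lerDr //; first by lra.
    by rewrite mulr_ge0 ?addr_ge0 ?mulr_ge0 // ltW.
  have gE F : 0 < F -> sigma k (x F) / F%:C%C = polar (- \sum_i f F i * l i k)
      (2 * pi * (ln F * theta 0 k) + - \sum_i f F i * a (i, k)).
    move=> F0; have -> : F%:C%C = polar (ln F) 0 :> R[i].
      by rewrite /polar lnK ?posrE // cos0 sin0 mulr1.
    rewrite sig_x -polarN -polarD; congr polar.
      have := log_x F k; rewrite mxE sig_x normc_polar expRK => ->.
      by rewrite mxE (negPf kk1) mulr1 addrC addKr.
    rewrite oppr0 addr0 mxE [ln F * _]mulrA [2 * pi * _]mulrC divfK ?mulf_neq0 ?gt_eqF //.
    rewrite mulr_sumr -sumrB; apply: eq_bigr => i _.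
    by rewrite qE mulrBl mulrA.
  rewrite !gE //.
  apply: (le_trans (flow_lipschitz theta beta k E E' (lM k) (aM k))).
  apply: (@le_trans _ _ (K * phase_dist theta beta E E')).
    by rewrite ler_wpM2r // /K lerDl ltW.
  by rewrite ler_wpM2l //; lra.
exists s, theta, beta, (C0 + B1 * K), (fun E => iota (x E)), U, V; split => //.
- by rewrite ltr_wpDr // mulr_ge0.
- move=> E E0.
  have [] := unit_renormalizes E0 (xU E) (near_x E) (UE E) (VE E).
  rewrite -/C0 => h1 h2 h3 h4 h5 h6 h7.
  have C0C : C0 <= C0 + B1 * K by rewrite lerDl mulr_ge0.
  have Ed0 : 0 < E ^+ d by rewrite exprn_gt0.
  split => //.
  + exact: le_trans h4 _.
  + by apply: le_trans h5 _; rewrite ler_pM2r ?mulr_gt0.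
  + move=> i j; apply: le_trans (h6 i j) _; rewrite ler_pM2r //.
    by rewrite addr_gt0 ?invr_gt0.
  + move=> y X yX j; apply: le_trans (h7 y X yX j) _; rewrite ler_wpM2r //.
    rewrite addr_ge0 ?mulr_ge0 ?invr_ge0 ?(ltW E0) ?(ltW Ed0) //.
    exact: le_trans (normr_ge0 _) (yX 0).
- move=> E E' i j E1 E1'.
  have D_ge0 := phase_dist_ge0 theta beta E E'.
  have iE : 0 <= E^-1 by rewrite invr_ge0 (le_trans _ E1).
  have iE' : 0 <= E'^-1 by rewrite invr_ge0 (le_trans _ E1').
  rewrite -normc_real rmorphB !rmorphM !rmorph_int !fmorphV.
  rewrite (int_mulmat_entry _ _ (UE E)) (int_mulmat_entry _ _ (UE E')).
  rewrite [X in normc X](_ : _ = \sum_k (S i k * sigma k (x E) * S' k j / E%:C%C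
      - S i k * sigma k (x E') * S' k j / E'%:C%C)); last by rewrite sumrB !mulr_suml.
  apply: (le_trans (normc_sum _)).
  apply: (@le_trans _ _ (\sum_k normc (S i k * S' k j)
      * (K * (phase_dist theta beta E E' + E^-1 + E'^-1)))).
    apply: ler_sum => k _.
    have -> : S i k * sigma k (x E) * S' k j / E%:C%C
        - S i k * sigma k (x E') * S' k j / E'%:C%C
      = S i k * S' k j * (sigma k (x E) / E%:C%C - sigma k (x E') / E'%:C%C) by ring.
    by rewrite normcM ler_wpM2l ?normc_ge0 // g_lip.
  rewrite -mulr_suml mulrA ler_wpM2r //; first by lra.
  apply: (@le_trans _ _ (B1 * K)); last by rewrite lerDr ltW.
  rewrite ler_wpM2r //.
  apply: (@le_trans _ _ (\sum_j \sum_k normc (S i k * S' k j))).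
    apply: (@le_sum_term _ (fun j => \sum_k normc (S i k * S' k j))) => ?.
    by apply: sumr_ge0 => ? _; exact: normc_ge0.
  apply: (@le_sum_term _ (fun i => \sum_j \sum_k normc (S i k * S' k j))) => ?.
  by do 2!apply: sumr_ge0 => ? _; exact: normc_ge0.
Qed.

End Flow.

Lemma renormalization (R : realType) (L : fieldExtType rat) (iota : {rmorphism L -> R})
    (d : nat) (b : d.+1.-tuple L) : basis_of fullv b ->
  exists (s : nat) (theta : 'rV[R]_d.+1) (beta : 'rV[R]_s)
    (C : R) (lam : R -> R) (U V : R -> 'M[int]_d.+1),
  [/\ (s <= d.+1)%N, 0 < C,
    forall E, 0 < E -> renormalizes (fun i => iota b`_i) C E (lam E) (U E) (V E)
    & forall E E' i j, 1 <= E -> 1 <= E' ->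
      `|(U E i j)%:~R / E - (U E' i j)%:~R / E'| <=
        C * (phase_dist theta beta E E' + E^-1 + E'^-1)].
Proof.
move=> b_basis.
have [sigma [k1 [sigma_k1 embU]]] := embeddings (real_complex R \o iota) b_basis.
exact: (renormalization_sigma b_basis sigma_k1 embU).
Qed.

(** * Gaps between consecutive levels *)
Section Gaps.
Variables (R : realType) (d : nat) (b : 'I_d.+1 -> R).
Hypotheses (b0 : b 0 = 1) (b_gt0 : forall i, 0 < b i).
Variables (C : R) (lam : R -> R) (U V : R -> 'M[int]_d.+1).
Hypothesis C_gt0 : 0 < C.
Hypothesis ren : forall E, 0 < E -> renormalizes b C E (lam E) (U E) (V E).

Definition form (m : 'rV[int]_d.+1) : R := \sum_i (m 0 i)%:~R * b i.

Lemma formD m m' : form (m + m') = form m + form m'.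
Proof. by rewrite -big_split; apply: eq_bigr => i _; rewrite mxE rmorphD mulrDl. Qed.

Lemma formN m : form (- m) = - form m.
Proof. by rewrite /form -sumrN; apply: eq_bigr => i _; rewrite mxE rmorphN mulNr. Qed.

Lemma form_renorm E w : 0 < E -> form (w *m U E) = lam E * form w.
Proof.
move=> E0; have [_ eig _ _ _ _ _] := ren E0.
rewrite /form mulr_sumr; under eq_bigr do rewrite mxE rmorph_sum mulr_suml.
rewrite exchange_big /=; apply: eq_bigr => i _; rewrite mulrCA -eig mulr_sumr.
by apply: eq_bigr => j _; rewrite rmorphM mulrA.
Qed.

Let B := \sum_i b i.
Let Binv := \sum_i (b i)^-1.

Let B_gt0 : 0 < B.
Proof. by rewrite /B (bigD1 0) //= ltr_wpDr // sumr_ge0 // => i _; rewrite ltW. Qed.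

Let bV_le i : (b i)^-1 <= Binv.
Proof.
by rewrite /Binv (bigD1 i) //= lerDl sumr_ge0 // => j _; rewrite invr_ge0 ltW.
Qed.

Let Binv_gt0 : 0 < Binv.
Proof. by apply: lt_le_trans (bV_le 0); rewrite invr_gt0. Qed.

Lemma large_coordinate E (m : 'rV[int]_d.+1) : E <= form m -> exists i, E / B <= (m 0 i)%:~R.
Proof.
move=> Em; apply: contrapT => /forallNP small; move: Em; apply/negP; rewrite -ltNge.
have -> : E = \sum_i E / B * b i by rewrite -mulr_sumr divfK // gt_eqF.
rewrite /form; apply: ltr_sum; first by apply/hasP; exists 0; rewrite ?mem_index_enum.
by move=> i _; rewrite ltr_pM2r // ltNge; apply/negP/small.
Qed.

(** Every point p of the kernel of the linear form is close to a lattice point with a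
    small positive value of the form: round the image of p under V and apply U.
    Adding N in the direction of value 1 before rounding makes the value
    positive. *)
Lemma near_kernel_point E (p : 'I_d.+1 -> R) : 0 < E -> \sum_i p i * b i = 0 ->
  exists v : 'rV[int]_d.+1,
  [/\ 0 < form v, form v <= C * (2 * B + 1) / E ^+ d
   & forall j, `|(v 0 j)%:~R - p j| <= (d.+1%:R * (B + 2) * C) * (E + E ^- d)].
Proof.
move=> E0 pb.
have [UV eig lam_gt0 lam_le _ U_le _] := ren E0.
have VU := mulmx1C UV.
have Ed0 : 0 < E ^+ d by rewrite exprn_gt0.
(* B bounds the effect of rounding on the form, so a shift by more than B is enough. *)
pose N := (Num.truncn B).+1.
have [N_lo N_hi] : B < N%:R /\ N%:R <= B + 1.
  by have /andP[] := truncn_itv (ltW B_gt0); rewrite /N -natr1 => ? ?; split; lra.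
pose y i := \sum_j p j * (V E j i)%:~R + (i == 0)%:R * N%:R.
pose w : 'rV[int]_d.+1 := \row_i Num.floor (y i).
pose e i := (w 0 i)%:~R - y i.
have e_le i : `|e i| <= 1.
  have := floor_itv (y i); rewrite /e mxE intrD.
  by rewrite ler_norml => /andP[? ?]; apply/andP; split; lra.
have VE j : \sum_i (V E j i)%:~R * b i = b j / lam E.
  apply: (mulIf (lt0r_neq0 lam_gt0)); rewrite divfK ?gt_eqF //.
  rewrite mulr_suml.
  under eq_bigr => i _ do rewrite -mulrA [b i * _]mulrC -eig mulr_sumr.
  rewrite exchange_big /=.
  have VUjk k : \sum_i (V E j i)%:~R * (U E i k)%:~R = (j == k)%:R :> R.
    have := congr1 (fun M : 'M[int]_d.+1 => (M j k)%:~R : R) VU.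
    rewrite /= !mxE rmorph_sum rmorph_nat /= => <-.
    by apply: eq_bigr => i _; rewrite rmorphM.
  under eq_bigr => k _ do (under eq_bigr => i _ do rewrite mulrA; rewrite -mulr_suml VUjk).
  rewrite (bigD1 j) //= eqxx mul1r big1 ?addr0 // => k /negPf.
  by rewrite eq_sym => ->; rewrite mul0r.
have form_w : form w = N%:R + \sum_i e i * b i.
  have -> : form w = \sum_i (y i + e i) * b i.
    by apply: eq_bigr => i _; rewrite /e addrC subrK.
  under eq_bigr do rewrite mulrDl.
  rewrite big_split /=; congr (_ + _).
  under eq_bigr do rewrite /y mulrDl.
  rewrite big_split /= [X in _ + X](bigD1 0) //= mul1r b0 mulr1.
  rewrite [X in _ + (_ + X)]big1 ?addr0 => [|i /negPf->]; last by rewrite !mul0r.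
  rewrite [X in X + _](_ : _ = 0) ?add0r //.
  under eq_bigr do rewrite mulr_suml.
  rewrite exchange_big /=.
  under eq_bigr => j _ do (under eq_bigr => i _ do rewrite -mulrA; rewrite -mulr_sumr VE mulrA).
  by rewrite -mulr_suml pb mul0r.
have eb : `|\sum_i e i * b i| <= B.
  apply: (le_trans (ler_norm_sum _ _ _)); apply: ler_sum => i _.
  by rewrite normrM (gtr0_norm (b_gt0 i)) ler_piMl // ltW.
have [fw0 fw1] : 0 < form w /\ form w <= 2 * B + 1.
  by rewrite form_w; move: eb; rewrite ler_norml => /andP[]; split; lra.
exists (w *m U E); split.
- by rewrite form_renorm // mulr_gt0.
- rewrite form_renorm // ler_pdivlMr // mulrAC.
  by apply: ler_pM => //; [rewrite mulr_ge0 // ltW | exact: ltW].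
- move=> j.
  have -> : ((w *m U E) 0 j)%:~R - p j = \sum_i (e i + (i == 0)%:R * N%:R) * (U E i j)%:~R.
    have -> : p j = \sum_i (\sum_k p k * (V E k i)%:~R) * (U E i j)%:~R.
      under eq_bigr do rewrite mulr_suml.
      rewrite exchange_big /=.
      have VUkj k : \sum_i (V E k i)%:~R * (U E i j)%:~R = (k == j)%:R :> R.
        have := congr1 (fun M : 'M[int]_d.+1 => (M k j)%:~R : R) VU.
        rewrite /= !mxE rmorph_sum rmorph_nat /= => <-.
        by apply: eq_bigr => i _; rewrite rmorphM.
      under eq_bigr => k _ do (under eq_bigr => i _ do rewrite -mulrA; rewrite -mulr_sumr VUkj).
      by rewrite (bigD1 j) //= eqxx mulr1 big1 ?addr0 // => k /negPf->; rewrite mulr0.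
    rewrite mxE rmorph_sum /= -sumrB; apply: eq_bigr => i _.
    by rewrite rmorphM /= -mulrBl /e /y; congr (_ * _); ring.
  apply: (le_trans (ler_norm_sum _ _ _)).
  apply: (@le_trans _ _ (\sum_(i < d.+1) (B + 2) * (C * (E + E ^- d)))).
    apply: ler_sum => i _; rewrite normrM; apply: ler_pM => //.
    apply: (le_trans (ler_normD _ _)).
    have := e_le i; rewrite normrM; case: eqP => _; rewrite ?normr1 ?normr0 ?mul1r ?mul0r.
      by rewrite ger0_norm //; lra.
    by lra.
  by rewrite sumr_const card_ord -[X in X <= _]mulr_natl !mulrA.
Qed.

(** A level of energy at least E has some coordinate of order E.  Lemma
    near_kernel_point, used at a scale kappa * E with a small kappa, gives a lattice
    vector v close to a point p of the kernel whose other coordinates are positive and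
    whose coordinate along that one is not too negative, so that m + v stays in the
    positive orthant.  When kappa * E < 1 the step of length 1 is good enough. *)
Lemma gap_exists : exists2 G : R, 0 < G & forall (E : R) (m : 'rV[int]_d.+1), 1 <= E ->
  (forall i, 0 <= m 0 i) -> E <= form m ->
  exists v : 'rV[int]_d.+1,
    [/\ 0 < form v, form v <= G / E ^+ d & forall i, 0 <= (m + v) 0 i].
Proof.
(* a is chosen so that a * (B * Binv + 1) = 1 / B, the bound of large_coordinate. *)
pose a := (B * (B * Binv + 1))^-1.
have a_gt0 : 0 < a by rewrite invr_gt0 mulr_gt0 // ltr_wpDl // mulr_ge0 // ltW.
pose K := d.+1%:R * (B + 2) * C.
have K_gt0 : 0 < K by rewrite !mulr_gt0 ?addr_gt0.
(* With this kappa the error in near_kernel_point is at most a * E once kappa * E >= 1. *)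
pose kappa := a / (2 * K).
have kappa_gt0 : 0 < kappa by rewrite divr_gt0 // mulr_gt0.
have kd0 : 0 < kappa ^- d by rewrite invr_gt0 exprn_gt0.
exists ((1 + C * (2 * B + 1)) * kappa ^- d).
  by rewrite mulr_gt0 // addr_gt0 // mulr_gt0 // addr_gt0 // mulr_gt0.
move=> E m E1 m_ge0 Em; have E0 : 0 < E by exact: lt_le_trans E1.
have Ed0 : 0 < E ^- d by rewrite invr_gt0 exprn_gt0.
have kE0 : 0 < kappa * E by rewrite mulr_gt0.
have [kE|kE] := ltP (kappa * E) 1.
  exists (delta_mx 0 0).
  have -> : form (delta_mx 0 0) = 1.
    rewrite /form (bigD1 0) //= mxE !eqxx b0 mul1r big1 ?addr0 // => i /negPf i0.
    by rewrite mxE i0 andbF mul0r.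
  split => //; last by move=> i; rewrite mxE addr_ge0 // mxE; case: (_ && _).
  rewrite -mulrA -[leLHS]mul1r; apply: ler_pM => //.
    by rewrite lerDl mulr_ge0 // ?ltW // addr_gt0 // mulr_gt0.
  rewrite -invfM -exprMn invf_ge1 ?exprn_gt0 //.
  by rewrite exprn_ile1 // ltW.
have [i0 mi0] := large_coordinate Em.
(* The coordinate i0 of p is fixed by the requirement that p is in the kernel. *)
pose p i := if i == i0 then - (a * E * (\sum_(j | j != i0) b j) / b i0) else a * E.
have pb : \sum_i p i * b i = 0.
  have pj j : j != i0 -> p j = a * E by rewrite /p => /negPf->.
  rewrite (bigD1 i0) //= {1}/p eqxx mulNr divfK ?gt_eqF //.
  under [X in _ + X]eq_bigr => j ji do rewrite pj //.
  by rewrite -mulr_sumr addNr.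
have [v [v_gt0 v_le vp]] := near_kernel_point kE0 pb.
have err j : `|(v 0 j)%:~R - p j| <= a * E.
  apply: le_trans (vp j) _; rewrite -/K.
  apply: (@le_trans _ _ (K * (kappa * E + kappa * E))).
    rewrite ler_pM2l // lerD2l.
    suff h : (kappa * E) ^- d <= 1 by exact: le_trans h kE.
    by rewrite invf_le1 ?exprn_gt0 // exprn_ege1.
  rewrite le_eqVlt; apply/orP; left; apply/eqP; rewrite /kappa; field.
  by rewrite gt_eqF.
exists v; split => //.
  apply: le_trans v_le _.
  by rewrite exprMn invfM mulrA !ler_pM2r // lerDr.
move=> i; rewrite mxE -(ler_int R) intrD.
have := err i; rewrite /p ler_norml; case: eqP => [->|_].
  move=> /andP[lo _].
  have sum_le : a * E * (\sum_(j | j != i0) b j) / b i0 <= a * E * (B * Binv).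
    rewrite -!mulrA ler_pM2l // ler_pM2l //; apply: ler_pM => //.
    - by apply: sumr_ge0 => j _; rewrite ltW.
    - by rewrite invr_ge0 ltW.
    - by rewrite /B [leRHS](bigD1 i0) //= lerDr ltW.
  have aEB : a * E * (B * Binv + 1) = E / B.
    rewrite /a; field; rewrite !gt_eqF // addr_gt0 // mulr_gt0 //.
  by move: mi0; rewrite -aEB; lra.
move=> /andP[lo _]; have : 0 <= (m 0 i)%:~R :> R by rewrite ler0z.
by lra.
Qed.

(** Renormalization turns the differences of neighbouring levels at scale E into
    lattice vectors from one finite box that does not depend on E. *)
Lemma small_difference X G : 0 <= X -> 0 <= G -> exists H : nat, forall E (v : 'rV[int]_d.+1),
  0 < E -> (forall i, `|(v 0 i)%:~R| <= X * E) -> `|form v| <= G / E ^+ d ->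
  exists2 w : 'rV[int]_d.+1, v = w *m U E & forall i, (`|w 0%R i| <= H)%N.
Proof.
move=> X0 G0; exists (Num.truncn (C * (X + G))) => E v E0 vX vG.
have [UV _ _ _ _ _ contr] := ren E0.
have Ed0 : 0 < E ^+ d by rewrite exprn_gt0.
exists (v *m V E); first by rewrite -mulmxA (mulmx1C UV) mulmx1.
move=> i; rewrite truncn_ge_nat ?mulr_ge0 ?addr_ge0 ?(ltW C_gt0) //.
rewrite natr_absz mxE intr_norm rmorph_sum /=.
under eq_bigr do rewrite rmorphM.
apply: le_trans (contr (fun i => (v 0 i)%:~R) _ vX i) _.
by rewrite ler_pM2l // mulfK ?gt_eqF // lerD2l -ler_pdivlMr.
Qed.

Definition is_level (x : R) : Prop :=
  exists2 m : 'rV[int]_d.+1, forall i, 0 <= m 0 i & x = form m.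

Lemma neighbour_difference : exists H : nat, forall E x y, 1 <= E ->
  is_level x -> is_level y -> E <= x -> x < y -> y < E + 1 ->
  (forall z, is_level z -> x < z -> y <= z) ->
  exists2 w : 'rV[int]_d.+1, y = x + form (w *m U E) & forall i, (`|w 0%R i| <= H)%N.
Proof.
have [G G_gt0 gap] := gap_exists.
have [H HP] := small_difference (ltW (mulr_gt0 (ltr0n R 2) Binv_gt0)) (ltW G_gt0).
exists H => E x y E1 [m m_ge0 xm] [m' m'_ge0 ym'] Ex xy yE next.
have E0 : 0 < E by exact: lt_le_trans E1.
have Em : E <= form m by rewrite -xm.
have [v [v_gt0 v_le v_ge0]] := gap E m E1 m_ge0 Em.
have y_le : y <= x + form v.
  apply: next; last by rewrite ltrDl.
  by exists (m + v) => //; rewrite formD xm.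
have coord_le (u : 'rV[int]_d.+1) i : (forall i, 0 <= u 0 i) -> form u < E + 1 ->
    (u 0 i)%:~R <= 2 * Binv * E.
  move=> u0 uE; apply: (@le_trans _ _ ((E + 1) * (b i)^-1)).
    rewrite ler_pdivlMr // (le_trans _ (ltW uE)) // /form (bigD1 i) //= lerDl.
    by apply: sumr_ge0 => j _; rewrite mulr_ge0 ?ler0z // ltW.
  rewrite mulrAC; apply: ler_pM => //; first by rewrite addr_ge0 // ltW.
    by rewrite invr_ge0 ltW.
  lra.
have [i||w wE wH] := HP E (m' - m) E0.
- have h1 : (m 0 i)%:~R <= 2 * Binv * E by apply: coord_le => //; rewrite -xm (lt_trans xy).
  have h2 : (m' 0 i)%:~R <= 2 * Binv * E by apply: coord_le => //; rewrite -ym'.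
  have h3 : 0 <= (m 0 i)%:~R :> R by rewrite ler0z.
  have h4 : 0 <= (m' 0 i)%:~R :> R by rewrite ler0z.
  by rewrite !mxE intrD rmorphN ler_norml; apply/andP; split; lra.
- rewrite formD formN -xm -ym' ger0_norm; last by rewrite subr_ge0 ltW.
  by apply: (le_trans _ v_le); rewrite lerBlDl.
exists w => //; rewrite -wE formD formN -xm -ym'; ring.
Qed.

End Gaps.

(** * Counting lattice points at two scales *)
Section Coupling.
Variable R : realType.

(** Length of the intersection of [a/E, (a+1)/E] and [a'/E', (a'+1)/E']. *)
Definition overlap (E E' : R) (a a' : nat) : R :=
  Num.max 0 (Num.min (a.+1%:R / E) (a'.+1%:R / E') - Num.max (a%:R / E) (a'%:R / E')).

Lemma overlap_sym E E' a a' : overlap E E' a a' = overlap E' E a' a.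
Proof. by rewrite /overlap minC [Num.max (_ / _) _]maxC. Qed.

Lemma overlap_ge0 E E' a a' : 0 <= overlap E E' a a'.
Proof. by rewrite le_max lexx. Qed.

Lemma overlap_neq0 E E' a a' : 0 < E -> 0 < E' -> overlap E E' a a' != 0 ->
  `|a%:R / E - a'%:R / E'| <= E^-1 + E'^-1.
Proof.
move=> E0 E0'; rewrite /overlap -!natr1 !mulrDl !mul1r.
have : 0 < E^-1 by rewrite invr_gt0.
have : 0 < E'^-1 by rewrite invr_gt0.
move: E^-1 E'^-1 (a%:R / E) (a'%:R / E') => u v x y v0 u0 h.
have {h} : 0 < Num.max 0 (Num.min (x + u) (y + v) - Num.max x y).
  by rewrite lt_neqAle eq_sym h le_max lexx.
rewrite lt_max ltxx /= subr_gt0 lt_min !gt_max => /andP[/andP[_ h1] /andP[h2 _]].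
by rewrite ler_norml; apply/andP; split; lra.
Qed.

(** The intervals of length 1/E' tile a half-line: as a difference of values of the
    clamping function to [a/E, (a+1)/E], the overlap telescopes. *)
Lemma sum_overlap E E' a N : 0 < E -> 0 < E' ->
  \sum_(a' < N) overlap E E' a a' <= E^-1 /\
  (a.+1%:R / E <= N%:R / E' -> \sum_(a' < N) overlap E E' a a' = E^-1).
Proof.
move=> E0 E0'.
have iE : 0 < E^-1 by rewrite invr_gt0.
have iE' : 0 < E'^-1 by rewrite invr_gt0.
(* clamp projects the line onto the interval [a/E, (a+1)/E]. *)
pose clamp (t : R) := Num.min (a.+1%:R / E) (Num.max (a%:R / E) t).
have aE : a.+1%:R / E = a%:R / E + E^-1 by rewrite -natr1 mulrDl mul1r.
have ovE a' : overlap E E' a a' = clamp (a'.+1%:R / E') - clamp (a'%:R / E').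
  rewrite /overlap /clamp aE -[a'.+1%:R]natr1 [(a'%:R + 1) / _]mulrDl mul1r.
  move: iE iE'; move: E^-1 E'^-1 (a%:R / E) (a'%:R / E') => u v x y u0 v0.
  by rewrite !(minElt, maxElt); do !case: ifP => //; lra.
have -> : \sum_(a' < N) overlap E E' a a' = clamp (N%:R / E') - clamp 0.
  under eq_bigr do rewrite ovE.
  rewrite -(big_mkord xpredT (fun a' => clamp (a'.+1%:R / E') - clamp (a'%:R / E'))).
  by rewrite (telescope_sumr (fun n => clamp (n%:R / E'))) // mul0r.
have -> : clamp 0 = a%:R / E.
  have : 0 <= a%:R / E by rewrite divr_ge0 // ltW.
  rewrite /clamp aE => x0; rewrite (max_idPl x0) (min_idPr _) //; lra.
rewrite /clamp aE; split; last first.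
  by move=> h; rewrite (min_idPl _) ?le_max ?h ?orbT // addrC addKr.
by rewrite lerBlDl ge_min lexx.
Qed.

(** Two normalized counts can be compared without a limiting volume: tile space by cubes of
    side 1/E and by cubes of side 1/E', and weigh a pair of cubes by the volume
    of their intersection, a product of overlaps.  Both counts become sums over
    pairs, and only pairs of intersecting cubes on which f and f' disagree
    contribute to the difference. *)
Lemma coupling (d N N' : nat) (E E' : R) (f bad : {ffun 'I_d -> 'I_N} -> bool)
    (f' : {ffun 'I_d -> 'I_N'} -> bool) : 0 < E -> 0 < E' ->
  (forall m : {ffun 'I_d -> 'I_N}, f m -> forall j, (m j).+1%:R / E <= N'%:R / E') ->
  (forall m : {ffun 'I_d -> 'I_N'}, f' m -> forall j, (m j).+1%:R / E' <= N%:R / E) ->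
  (forall (m : {ffun 'I_d -> 'I_N}) (m' : {ffun 'I_d -> 'I_N'}),
     (forall j, `|(m j)%:R / E - (m' j)%:R / E'| <= E^-1 + E'^-1) ->
     f m != f' m' -> bad m) ->
  `|#|[pred m | f m]|%:R / E ^+ d - #|[pred m | f' m]|%:R / E' ^+ d|
    <= #|[pred m | bad m]|%:R / E ^+ d.
Proof.
move=> E0 E0' fN fN' fbad.
pose w (m : {ffun 'I_d -> 'I_N}) (m' : {ffun 'I_d -> 'I_N'}) :=
  \prod_j overlap E E' (m j) (m' j).
have w_ge0 m m' : 0 <= w m m' by apply: prodr_ge0 => j _; exact: overlap_ge0.
have sumw m : \sum_m' w m m' = \prod_j \sum_(a' < N') overlap E E' (m j) a'.
  by rewrite bigA_distr_bigA.
have sumw' m' : \sum_m w m m' = \prod_j \sum_(a < N) overlap E' E (m' j) a.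
  rewrite bigA_distr_bigA; apply: eq_bigr => m _; apply: eq_bigr => j _.
  exact: overlap_sym.
have mass_le m : \sum_m' w m m' <= E ^- d.
  rewrite sumw -exprVn -[d in leRHS]card_ord -prodr_const; apply: ler_prod => j _.
  rewrite (sum_overlap (m j) N' E0 E0').1 andbT.
  by apply: sumr_ge0 => a _; exact: overlap_ge0.
have mass m : f m -> \sum_m' w m m' = E ^- d.
  move=> fm; rewrite sumw -exprVn -[d in RHS]card_ord -prodr_const; apply: eq_bigr => j _.
  exact: (sum_overlap (m j) N' E0 E0').2 (fN m fm j).
have mass' m' : f' m' -> \sum_m w m m' = E' ^- d.
  move=> fm; rewrite sumw' -exprVn -[d in RHS]card_ord -prodr_const; apply: eq_bigr => j _.
  exact: (sum_overlap (m' j) N E0' E0).2 (fN' m' fm j).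
have cardE (I : finType) (g : pred I) (x : R) :
    #|[pred m | g m]|%:R * x = \sum_m (g m)%:R * x.
  rewrite -mulr_suml -sum1_card natr_sum big_mkcond; congr (_ * _).
  by apply: eq_bigr => m _; rewrite inE; case: (g m).
rewrite !cardE.
have -> : \sum_m (f m)%:R * E ^- d = \sum_m \sum_m' (f m)%:R * w m m'.
  apply: eq_bigr => m _; rewrite -mulr_sumr.
  by have := mass m; case: (f m) => [->//|_]; rewrite !mul0r.
have -> : \sum_m (f' m)%:R * E' ^- d = \sum_m \sum_m' (f' m')%:R * w m m'.
  rewrite exchange_big /=; apply: eq_bigr => m _; rewrite -mulr_sumr.
  by have := mass' m; case: (f' m) => [->//|_]; rewrite !mul0r.
rewrite -sumrB; apply: (le_trans (ler_norm_sum _ _ _)); apply: ler_sum => m _.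
rewrite -sumrB; apply: (le_trans (ler_norm_sum _ _ _)).
apply: (@le_trans _ _ (\sum_m' (bad m)%:R * w m m')); last first.
  by rewrite -mulr_sumr; apply: ler_wpM2l.
apply: ler_sum => m' _; rewrite -mulrBl normrM (ger0_norm (w_ge0 _ _)).
have [->|w0] := eqVneq (w m m') 0; first by rewrite !mulr0.
apply: ler_wpM2r => //.
have near j : `|(m j)%:R / E - (m' j)%:R / E'| <= E^-1 + E'^-1.
  apply: overlap_neq0 => //; apply: contra_neq w0 => ov.
  by rewrite /w (bigD1 j) //= ov mul0r.
have := fbad m m' near; case: (f m) (f' m') => -[] // ; rewrite ?subrr ?normr0 // => ->//.
  by rewrite subr0 normr1.
by rewrite sub0r normrN normr1.
Qed.

Lemma eqn_mod_close (D a b : nat) : (0 < D)%N -> a = b %[mod D] ->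
  (b < a + D)%N -> (a < D + b)%N -> a = b.
Proof.
move=> D0 ab; rewrite (divn_eq a D) (divn_eq b D) ab.
have := ltn_pmod b D0; move: (a %/ D)%N (b %/ D)%N (b %% D)%N => p q r rD h1 h2.
suff -> : p = q by [].
apply/eqP; rewrite eqn_leq; apply/andP.
by split; rewrite -ltnS -(ltn_pmul2r D0) mulSn; lia.
Qed.

(** In a slab of the box, the other coordinates confine the coordinate j0 to an
    interval of length 2 r / g j0; hence replacing that coordinate by its
    residue modulo a larger integer is injective. *)
Lemma thin_count (d N B : nat) (g : 'I_d -> R) (j0 : 'I_d) (c r : R) : 0 < g j0 -> 0 <= r ->
  (#|[pred m : {ffun 'I_d -> 'I_N} | [forall j, (m j < B)%N]
       && (`|\sum_j g j * (m j)%:R - c| <= r)%R]|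
   <= (Num.truncn (2 * r / g j0)).+1 * B ^ d.-1)%N.
Proof.
move=> g0 r0; set D := (Num.truncn _).+1; set A := [pred m | _].
pose F (j : 'I_d) : pred 'I_(maxn D B).+1 := fun x => if j == j0 then (x < D)%N else (x < B)%N.
have -> : (D * B ^ d.-1)%N = #|(family F : simpl_pred {ffun 'I_d -> 'I_(maxn D B).+1})|.
  have cardlt n : (n <= maxn D B)%N -> #|[pred x : 'I_(maxn D B).+1 | (x < n)%N]| = n.
    move=> nle; rewrite -sum1_card (eq_bigl (fun x : 'I_(maxn D B).+1 => (x < n)%N)) //.
    by rewrite (big_ord_narrow (leqW nle)) sum1_card card_ord.
  rewrite card_family foldrE big_map big_enum /= (bigD1 j0) //=.
  rewrite (eq_card (B := [pred x : 'I_(maxn D B).+1 | (x < D)%N])); last first.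
    by move=> x; rewrite !inE /F /in_mem /= eqxx.
  rewrite cardlt ?leq_maxl // (eq_bigr (fun=> B)) => [|j jj0].
    by rewrite prod_nat_const cardC1 card_ord.
  rewrite (eq_card (B := [pred x : 'I_(maxn D B).+1 | (x < B)%N])) ?cardlt ?leq_maxr //.
  by move=> x; rewrite !inE /F /in_mem /= (negPf jj0).
(* The target ordinals have size (maxn D B).+1 so that both kinds of entries fit. *)
pose phi (m : {ffun 'I_d -> 'I_N}) : {ffun 'I_d -> 'I_(maxn D B).+1} :=
  [ffun j => inord (if j == j0 then (m j %% D)%N else m j)].
have D_gt0 : (0 < D)%N by [].
have phiE m j : m \in A -> (phi m j : nat) = if j == j0 then (m j %% D)%N else m j.
  rewrite inE => /andP[/forallP mB _]; rewrite ffunE inordK // ltnS.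
  case: ifP => _; first by rewrite leq_max ltnW // ltn_mod.
  by rewrite leq_max (ltnW (mB j)) orbT.
rewrite -(card_in_imset (f := phi) (D := A)).
  apply: subset_leq_card; apply/fintype.subsetP => _ /imsetP[m mA ->].
  apply/familyP => j; rewrite /F unfold_in /= phiE //.
  case: (j == j0); first by rewrite ltn_mod.
  by move: mA; rewrite inE => /andP[/forallP].
move=> m m' mA m'A e.
have others j : j != j0 -> m j = m' j.
  move=> /negPf jj0; apply/val_inj => /=.
  have := congr1 (fun u : {ffun 'I_d -> 'I_(maxn D B).+1} => u j : nat) e.
  by rewrite /= !phiE // jj0.
have md : (m j0 = m' j0 %[mod D])%N.
  have := congr1 (fun u : {ffun 'I_d -> 'I_(maxn D B).+1} => u j0 : nat) e.
  by rewrite /= !phiE // eqxx.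
have close : `|(m j0)%:R - (m' j0)%:R| <= 2 * r / g j0 :> R.
  rewrite ler_pdivlMr //.
  have : `|\sum_j g j * (m j)%:R - \sum_j g j * (m' j)%:R| <= 2 * r.
    move: mA m'A; rewrite !inE => /andP[_ h1] /andP[_ h2].
    by move: h1 h2; rewrite !ler_norml => /andP[? ?] /andP[? ?]; apply/andP; split; lra.
  rewrite -sumrB (bigD1 j0) //= big1 => [|j /others->]; last by rewrite subrr.
  by rewrite addr0 -mulrBr normrM (gtr0_norm g0) mulrC.
have lt_D : `|(m j0)%:R - (m' j0)%:R| < D%:R :> R.
  exact: le_lt_trans close (truncnS_gt _).
apply/ffunP => j; have [->|/others//] := eqVneq j j0; apply/val_inj => /=.
move: lt_D md; rewrite ltr_norml => /andP[].
rewrite ltrBrDr ltrBlDr -!natrD.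
have -> : - D%:R + (m' j0)%:R < (m j0)%:R :> R = (m' j0 < m j0 + D)%N.
  by rewrite -(ltr_nat R) natrD; apply/idP/idP; lra.
rewrite ltr_nat => h1 h2 md.
exact: (eqn_mod_close D_gt0 md).
Qed.

End Coupling.

(** * Cells of the simplex cut out by moving walls *)
Section Cells.
Variables (R : realType) (d : nat) (omega : 'I_d -> R).
Hypotheses (d_gt0 : (0 < d)%N) (omega_gt0 : forall j, 0 < omega j).

Definition wsum (N : nat) (m : {ffun 'I_d -> 'I_N}) : R := \sum_j omega j * (m j)%:R.

(** The coordinates of the only level in [E, E + 1) whose last d coordinates are m,
    provided that wsum m < E + 1: the coordinate ord0 is then forced. *)
Definition level_coord (E : R) (N : nat) (m : {ffun 'I_d -> 'I_N}) (i : 'I_d.+1) : int :=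
  if unlift ord0 i is Some j then Posz (m j) else Num.max 0 (Num.ceil (E - wsum m)).

(** A cell is described by the truth values Q of finitely many comparisons between a
    coordinate of the level and a wall at height c t * E. *)
Definition cell (T : finType) (ix : T -> 'I_d.+1) (E : R) (c : T -> R)
    (Q : {ffun T -> bool} -> bool) (N : nat) : pred {ffun 'I_d -> 'I_N} :=
  [pred m | (wsum m < E + 1) && Q [ffun t => c t * E <= (level_coord E m (ix t))%:~R]].

Let W := \sum_j omega j.
Let Winv := \sum_j (omega j)^-1.

Let omegaV_le j : (omega j)^-1 <= Winv.
Proof.
by rewrite /Winv (bigD1 j) //= lerDl sumr_ge0 // => i _; rewrite invr_ge0 ltW.
Qed.

Let W_ge0 : 0 <= W.
Proof. by apply: sumr_ge0 => j _; rewrite ltW. Qed.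

Let Winv_ge0 : 0 <= Winv.
Proof. by apply: sumr_ge0 => j _; rewrite invr_ge0 ltW. Qed.

Lemma coord_le_wsum N (m : {ffun 'I_d -> 'I_N}) j s : wsum m <= s -> (m j)%:R <= Winv * s.
Proof.
move=> ms; have s0 : 0 <= s.
  by apply: le_trans ms; apply: sumr_ge0 => i _; rewrite mulr_ge0 // ltW.
apply: (@le_trans _ _ ((omega j)^-1 * s)); last by rewrite ler_wpM2r.
rewrite mulrC ler_pdivlMr // mulrC (le_trans _ ms) // /wsum (bigD1 j) //= lerDl.
by apply: sumr_ge0 => i _; rewrite mulr_ge0 // ltW.
Qed.

Lemma coord0_approx (E : R) N (m : {ffun 'I_d -> 'I_N}) : wsum m < E + 1 ->
  `|(level_coord E m ord0)%:~R - (E - wsum m)| <= 1.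
Proof.
rewrite /level_coord unlift_none; move: (wsum m) => s sE.
have := ceil_itv (E - s) => /andP[h1 h2].
have -> : Num.max 0 (Num.ceil (E - s)) = Num.ceil (E - s).
  by apply/max_idPr; rewrite ceil_ge0; lra.
by rewrite intrD in h1; rewrite ler_norml; apply/andP; split; lra.
Qed.

Lemma coord_lift (E : R) N (m : {ffun 'I_d -> 'I_N}) j :
  level_coord E m (lift ord0 j) = Posz (m j).
Proof. by rewrite /level_coord liftK. Qed.

(** Up to a bounded error the coordinate ord0 of a level is E - wsum m, whence the
    shape of the second case.  For c = 0 that case is the outer face of the
    simplex. *)
Definition near_wall (E : R) (B : nat) (c rho : R) (i : 'I_d.+1) N
    (m : {ffun 'I_d -> 'I_N}) : bool :=
  [forall j, (m j < B)%N] &&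
  (if unlift ord0 i is Some j then `|(m j)%:R / E - c| <= rho
   else `|1 - wsum m / E - c| <= rho).

Lemma near_wall_count (E : R) B c rho i N : 0 < E -> 0 <= rho ->
  #|[pred m : {ffun 'I_d -> 'I_N} | near_wall E B c rho i m]|%:R
    <= (2 * rho * E * (Winv + 1) + 1) * B%:R ^+ d.-1 :> R.
Proof.
move=> E0 rho0.
have bound g (j0 : 'I_d) (c' : R) : 0 < g j0 -> (g j0)^-1 <= Winv + 1 ->
    (forall m : {ffun 'I_d -> 'I_N}, near_wall E B c rho i m -> [forall j, (m j < B)%N]
       && (`|\sum_j g j * (m j)%:R - c'| <= rho * E)) ->
    #|[pred m : {ffun 'I_d -> 'I_N} | near_wall E B c rho i m]|%:R
      <= (2 * rho * E * (Winv + 1) + 1) * B%:R ^+ d.-1 :> R.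
  move=> g0 gW sub.
  have rE0 : 0 <= rho * E by rewrite mulr_ge0 // ltW.
  have le1 := @thin_count R d N B g j0 c' (rho * E) g0 rE0.
  apply: (@le_trans _ _ (((Num.truncn (2 * (rho * E) / g j0)).+1 * B ^ d.-1)%N%:R)).
    rewrite ler_nat; apply: leq_trans le1; apply: subset_leq_card.
    by apply/fintype.subsetP => m; rewrite !inE => /sub.
  rewrite natrM natrX ler_wpM2r ?exprn_ge0 // -natr1 lerD2r.
  apply: (@le_trans _ _ (2 * (rho * E) / g j0)).
    by rewrite truncn_le // divr_ge0 ?mulr_ge0 // ltW.
  by rewrite !mulrA ler_wpM2l // !mulr_ge0 // ltW.
case: (unliftP ord0 i) => [j|] ei.
  apply: (@bound (fun j' => (j' == j)%:R) j (c * E)).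
  - by rewrite eqxx ltr01.
  - by rewrite eqxx invr1 lerDr.
  move=> m; rewrite /near_wall ei liftK => /andP[-> h] /=.
  rewrite (bigD1 j) //= eqxx mul1r big1 ?addr0 => [|k /negPf->]; last by rewrite mul0r.
  rewrite (_ : _ - _ = ((m j)%:R / E - c) * E); last by field; rewrite gt_eqF.
  by rewrite normrM (gtr0_norm E0) ler_pM2r.
pose j0 : 'I_d := Ordinal d_gt0.
apply: (@bound omega j0 ((1 - c) * E)) => //.
  by rewrite (le_trans (omegaV_le _)) // lerDl.
move=> m; rewrite /near_wall ei unlift_none => /andP[-> h] /=.
rewrite -/(wsum m) (_ : _ - _ = - ((1 - wsum m / E - c) * E)); last by field; rewrite gt_eqF.
by rewrite normrN normrM (gtr0_norm E0) ler_pM2r.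
Qed.

(** Points of the two lattices in intersecting cubes have normalized coordinates
    within O(1/E + 1/E') of each other.  If they lie in different cells, then one
    of the comparisons has different outcomes, and the first point is near one of
    finitely many walls, where there are O(E^(d - 1)) points for each unit of width. *)
Lemma compare_cells (T : finType) (ix : T -> 'I_d.+1) : exists2 K : R, 0 <= K &
  forall (E E' : R) (c c' : T -> R) (delta : R) (Q : {ffun T -> bool} -> bool) (N N' : nat),
  1 <= E -> 1 <= E' -> (forall t, `|c t - c' t| <= delta) -> 0 <= delta ->
  (2 * Winv + 1) * E <= N%:R -> (2 * Winv + 1) * E' <= N'%:R ->
  `|#|cell ix E c Q (N := N)|%:R / E ^+ d - #|cell ix E' c' Q (N := N')|%:R / E' ^+ d|
    <= K * (delta + E^-1 + E'^-1).
Proof.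
(* W accounts for the change of wsum between the points, 2 for a coordinate and for rounding. *)
pose K1 := W + 2.
exists ((#|T|%:R + 1) * ((2 * K1 * (Winv + 1) + 1) * (2 * Winv + 3) ^+ d.-1)).
  by rewrite !mulr_ge0 ?exprn_ge0 ?addr_ge0 ?mulr_ge0 ?addr_ge0.
move=> E E' c c' delta Q N N' E1 E1' cc' delta0 NE NE'.
have E0 : 0 < E by exact: lt_le_trans E1.
have E0' : 0 < E' by exact: lt_le_trans E1'.
have iE : 0 < E^-1 by rewrite invr_gt0.
have iE' : 0 < E'^-1 by rewrite invr_gt0.
have iE1 : E^-1 <= 1 by rewrite invf_le1.
have iE1' : E'^-1 <= 1 by rewrite invf_le1.
pose rho := K1 * (delta + E^-1 + E'^-1).
have rho0 : 0 <= rho by rewrite mulr_ge0 ?addr_ge0 // ltW.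
pose B := (Num.truncn ((2 * Winv + 2) * E)).+1.
pose bad (m : {ffun 'I_d -> 'I_N}) :=
  near_wall E B 0 rho ord0 m || [exists t, near_wall E B (c t) rho (ix t) m].
have cell_coord F (F1 : 1 <= F) M (m : {ffun 'I_d -> 'I_M}) b Q' j :
    m \in cell ix F b Q' (N := M) -> (m j)%:R / F <= 2 * Winv.
  rewrite inE => /andP[/ltW /coord_le_wsum-/(_ j) h _].
  rewrite ler_pdivrMr ?(lt_le_trans _ F1) // (le_trans h) //.
  have : 0 <= Winv * (F - 1) by rewrite mulr_ge0 // subr_ge0.
  by lra.
have range F (F1 : 1 <= F) M (m : {ffun 'I_d -> 'I_M}) b Q' j F' M' : 0 < F' ->
    (2 * Winv + 1) * F' <= M'%:R -> m \in cell ix F b Q' (N := M) ->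
    (m j).+1%:R / F <= M'%:R / F'.
  move=> F0' MF' /(cell_coord F F1)-/(_ j) h; apply: (@le_trans _ _ (2 * Winv + 1)).
    by rewrite -natr1 mulrDl lerD // mul1r invf_le1 // (lt_le_trans _ F1).
  by rewrite ler_pdivlMr.
apply: le_trans (coupling (f := fun m => m \in cell ix E c Q (N := N))
    (f' := fun m => m \in cell ix E' c' Q (N := N')) (bad := bad) E0 E0' _ _ _) _.
- by move=> m fm j; apply: (range E E1 N m c Q) => //.
- by move=> m fm j; apply: (range E' E1' N' m c' Q) => //.
- move=> m m' close ff'.
  have box : [forall j, (m j < B)%N].
    apply/forallP => j; rewrite ltnS truncn_ge_nat; last first.
      by rewrite mulr_ge0 ?addr_ge0 ?mulr_ge0 // ltW.
    rewrite -ler_pdivrMr //.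
    move: ff'; have [fm _|_] := boolP (m \in cell ix E c Q (N := N)).
      by rewrite (le_trans (cell_coord E E1 N m c Q j fm)) // lerDl.
    rewrite eq_sym eqbF_neg negbK => fm'.
    have := cell_coord E' E1' N' m' c' Q j fm'; have := close j.
    by rewrite ler_norml => /andP[_]; lra.
  have [//|/norP[]] := boolP (bad m).
  rewrite /near_wall box unlift_none /= subr0 -ltNge => far0 /existsPn far.
  pose sg := wsum m / E; pose sg' := wsum m' / E'.
  have sgsg' : `|sg - sg'| <= W * (E^-1 + E'^-1).
    rewrite /sg /sg' /wsum /W !mulr_suml -sumrB.
    apply: (le_trans (ler_norm_sum _ _ _)); apply: ler_sum => j _.
    by rewrite -!mulrA -mulrBr normrM (gtr0_norm (omega_gt0 j)) ler_pM2l.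
  have rhoE : rho = W * (delta + E^-1 + E'^-1) + 2 * (delta + E^-1 + E'^-1).
    by rewrite /rho /K1 mulrDl.
  have Wd : 0 <= W * delta by rewrite mulr_ge0.
  have simpE F M (u : {ffun 'I_d -> 'I_M}) : 0 < F ->
      (wsum u < F + 1) = (wsum u / F < 1 + F^-1).
    by move=> F0; rewrite ltr_pdivrMr // mulrDl mul1r mulVf // gt_eqF.
  have same_simp : (wsum m < E + 1) = (wsum m' < E' + 1).
    rewrite !simpE // -/sg -/sg'; move: far0; rewrite -/sg ltr_normr => /orP[]h.
      have -> : sg < 1 + E^-1 by move: sgsg'; rewrite ler_norml => /andP[? ?]; lra.
      by apply/esym; move: sgsg'; rewrite ler_norml => /andP[? ?]; lra.
    have /negbTE -> : ~~ (sg < 1 + E^-1).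
      by rewrite -leNgt; move: sgsg'; rewrite ler_norml => /andP[? ?]; lra.
    by apply/esym/negbTE; rewrite -leNgt; move: sgsg'; rewrite ler_norml => /andP[? ?]; lra.
  move: ff'; rewrite !inE same_simp; case: (boolP (wsum m' < E' + 1)) => //= sm'.
  have sm : wsum m < E + 1 by rewrite same_simp.
  suff -> : [ffun t => c t * E <= (level_coord E m (ix t))%:~R] =
     [ffun t => c' t * E' <= (level_coord E' m' (ix t))%:~R] by rewrite eqxx.
  apply/ffunP => t; rewrite !ffunE -!ler_pdivlMr //.
  have := cc' t; have := far t; rewrite /=.
  case: (unliftP ord0 (ix t)) => [j|] ->.
    rewrite ?liftK !coord_lift -ltNge ltr_normr => fart; rewrite ler_norml => /andP[cc1 cc2].
    have := close j; rewrite ler_norml => /andP[cl1 cl2].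
    have Wiv : 0 <= W * (E^-1 + E'^-1) by rewrite mulr_ge0 // addr_ge0 // ltW.
    case/orP: fart => fart.
      have -> : c t <= (m j)%:R / E by lra.
      by apply/esym; lra.
    have /negbTE -> : ~~ (c t <= (m j)%:R / E) by rewrite -ltNge; lra.
    by apply/esym/negbTE; rewrite -ltNge; lra.
  rewrite ?unlift_none -ltNge ltr_normr -/sg => fart; rewrite ler_norml => /andP[cc1 cc2].
  have apx F M (u : {ffun 'I_d -> 'I_M}) : 0 < F -> wsum u < F + 1 ->
      `|(level_coord F u ord0)%:~R / F - (1 - wsum u / F)| <= F^-1.
    move=> F0 /coord0_approx h.
    rewrite (_ : _ - _ = ((level_coord F u ord0)%:~R - (F - wsum u)) / F); last first.
      by field; rewrite gt_eqF.
    by rewrite normrM (gtr0_norm (_ : 0 < F^-1)) ?invr_gt0 // ler_piMl // invr_ge0 ltW.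
  have := apx E N m E0 sm; have := apx E' N' m' E0' sm'; rewrite -/sg -/sg' !ler_norml.
  move=> /andP[b1 b2] /andP[b3 b4]; move: sgsg'; rewrite ler_norml => /andP[b5 b6].
  case/orP: fart => fart.
    have -> : c t <= (level_coord E m ord0)%:~R / E by lra.
    by apply/esym; lra.
  have /negbTE -> : ~~ (c t <= (level_coord E m ord0)%:~R / E) by rewrite -ltNge; lra.
  by apply/esym/negbTE; rewrite -ltNge; lra.
have bad_le : #|[pred m | bad m]|%:R <=
    (#|T|%:R + 1) * ((2 * rho * E * (Winv + 1) + 1) * B%:R ^+ d.-1) :> R.
  apply: (@le_trans _ _ ((#|[pred m : {ffun 'I_d -> 'I_N} | near_wall E B 0 rho ord0 m]|
      + \sum_t #|[pred m : {ffun 'I_d -> 'I_N} | near_wall E B (c t) rho (ix t) m]|)%N%:R)).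
    rewrite ler_nat -!sum1_card; under [X in (_ <= _ + X)%N]eq_bigr do rewrite -sum1_card.
    rewrite [leqLHS]big_mkcond [X in (_ <= X + _)%N]big_mkcond.
    under [X in (_ <= _ + X)%N]eq_bigr do rewrite big_mkcond.
    rewrite exchange_big -big_split /=; apply: leq_sum => m _; rewrite !inE /bad.
    case: (near_wall E B 0 rho ord0 m) => //=; case: existsP => // -[t ht].
    by rewrite (bigD1 t) //= inE ht.
  rewrite natrD natr_sum mulrDl mul1r [leRHS]addrC; apply: lerD; first exact: near_wall_count.
  apply: (@le_trans _ _ (\sum_(t : T) (2 * rho * E * (Winv + 1) + 1) * B%:R ^+ d.-1)).
    by apply: ler_sum => t _; exact: near_wall_count.
  by rewrite sumr_const [leRHS]mulr_natl.
rewrite ler_pdivrMr ?exprn_gt0 //; apply: (le_trans bad_le).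
rewrite -!(mulrA (#|T|%:R + 1)) ler_wpM2l ?addr_ge0 //.
have B_le : B%:R <= (2 * Winv + 3) * E.
  have x0 : 0 <= (2 * Winv + 2) * E by rewrite mulr_ge0 ?addr_ge0 ?mulr_ge0 // ltW.
  have /andP[h _] := truncn_itv x0; rewrite /B -natr1.
  by lra.
have Bd : B%:R ^+ d.-1 <= (2 * Winv + 3) ^+ d.-1 * E ^+ d.-1.
  by rewrite -exprMn lerXn2r // nnegrE ?mulr_ge0 ?addr_ge0 ?mulr_ge0 // ltW.
apply: (@le_trans _ _ ((2 * rho * E * (Winv + 1) + 1) * ((2 * Winv + 3) ^+ d.-1 * E ^+ d.-1))).
  by rewrite ler_wpM2l // !addr_ge0 ?mulr_ge0 ?addr_ge0 // ltW.
have -> : E ^+ d = E * E ^+ d.-1 by rewrite -exprS prednK.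
have P0 : 0 <= (2 * Winv + 3) ^+ d.-1 * E ^+ d.-1.
  by rewrite mulr_ge0 ?exprn_ge0 ?addr_ge0 ?mulr_ge0 // ltW.
set P := (2 * Winv + 3) ^+ d.-1 * E ^+ d.-1 in P0 *.
rewrite [leRHS](_ : _ =
  (2 * K1 * (Winv + 1) + 1) * ((delta + E^-1 + E'^-1) * E) * P); last first.
  by rewrite /P; ring.
rewrite ler_wpM2r // [leRHS]mulrDl lerD //.
  by rewrite /rho le_eqVlt; apply/orP; left; apply/eqP; ring.
rewrite mul1r !mulrDl mulVf ?gt_eqF //.
have h1 : 0 <= delta * E by rewrite mulr_ge0 // ltW.
have h2 : 0 <= E'^-1 * E by rewrite mulr_ge0 // ltW.
lra.
Qed.

End Cells.

(** * Energy levels as lattice points *)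
Section Levels.
Variables (R : realType) (d : nat) (omega : 'I_d -> R).
Hypothesis omega_gt0 : forall j, 0 < omega j.

(** The frequencies of all d + 1 oscillators, the normalized one coming first. *)
Definition freq (i : 'I_d.+1) : R := if unlift ord0 i is Some j then omega j else 1.

Lemma freq0 : freq 0 = 1.
Proof. by rewrite /freq unlift_none. Qed.

Lemma freq_gt0 i : 0 < freq i.
Proof. by rewrite /freq; case: unlift. Qed.

Lemma formE (m : 'rV[int]_d.+1) :
  form freq m = (m 0 ord0)%:~R + \sum_j (m 0 (lift ord0 j))%:~R * omega j.
Proof.
rewrite /form big_ord_recl /freq unlift_none mulr1; congr (_ + _).
by apply: eq_bigr => j _; rewrite liftK.
Qed.

Lemma energy_levelP x : energy_level omega x <-> is_level freq x.
Proof.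
split=> [[m0 [m ->]]|[m m_ge0 ->]].
  exists (\row_i (if unlift ord0 i is Some j then Posz (m j) else Posz m0)).
    by move=> i; rewrite mxE; case: unlift.
  rewrite formE mxE unlift_none; congr (_ + _).
  by apply: eq_bigr => j _; rewrite mxE liftK.
exists `|m 0%R ord0|%N, (fun j => `|m 0%R (lift ord0 j)|%N); rewrite formE.
congr (_ + _); first by rewrite natr_absz ger0_norm.
by apply: eq_bigr => j _; rewrite natr_absz ger0_norm.
Qed.

Hypothesis form_inj : forall m m', form freq m = form freq m' -> m = m'.

Definition level_vector (E : R) (N : nat) (m : {ffun 'I_d -> 'I_N}) : 'rV[int]_d.+1 :=
  \row_i level_coord omega E m i.

Lemma form_level_vector E N (m : {ffun 'I_d -> 'I_N}) :
  form freq (level_vector E m) = (level_coord omega E m ord0)%:~R + wsum omega m.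
Proof.
rewrite formE mxE; congr (_ + _); apply: eq_bigr => j _.
by rewrite mxE coord_lift mulrC.
Qed.

Lemma coord_ge0 E N (m : {ffun 'I_d -> 'I_N}) i : 0 <= level_coord omega E m i.
Proof. by rewrite /level_coord; case: unlift => // ; rewrite le_max lexx. Qed.

Lemma level_vector_window E N (m : {ffun 'I_d -> 'I_N}) : wsum omega m < E + 1 ->
  E <= form freq (level_vector E m) < E + 1.
Proof.
move=> mE; rewrite form_level_vector /level_coord unlift_none.
have -> : Num.max 0 (Num.ceil (E - wsum omega m)) = Num.ceil (E - wsum omega m).
  by apply/max_idPr; rewrite ceil_ge0; lra.
have /andP[] := ceil_itv (E - wsum omega m); rewrite intrD => h1 h2.
by apply/andP; split; lra.
Qed.

Let Winv := \sum_j (omega j)^-1.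

(** N is a bound on the coordinates of all levels below E + 1. *)
Lemma count_levels (E : R) (N : nat) (a : pred R) : 1 <= E -> (2 * Winv + 1) * E <= N%:R ->
  count a (levels omega E) =
  #|[pred m : {ffun 'I_d -> 'I_N} | (wsum omega m < E + 1) && a (form freq (level_vector E m))]|.
Proof.
move=> E1 NE; have E0 : 0 < E by exact: lt_le_trans E1.
pose s := [seq form freq (level_vector E m) |
  m <- enum [pred m : {ffun 'I_d -> 'I_N} | wsum omega m < E + 1]].
have s_uniq : uniq s.
  rewrite map_inj_uniq ?enum_uniq // => m m' /form_inj /rowP mm.
  by apply/ffunP => j; apply/val_inj; have := mm (lift ord0 j); rewrite !mxE !coord_lift => -[].
have lev_uniq : uniq (levels omega E).
  by have := levels_sorted omega E; apply: sorted_uniq; [exact: lt_trans | exact: ltxx].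
have perm : perm_eq (levels omega E) s.
  apply: uniq_perm => // x; apply/idP/idP.
    move=> /(mem_levels E x omega_gt0)[/energy_levelP[m m_ge0 xm] /andP[Ex xE]].
    pose t := \sum_j (m 0 (lift ord0 j))%:~R * omega j.
    have m0_ge0 : 0 <= (m 0 ord0)%:~R :> R by rewrite ler0z.
    have tE : t < E + 1 by move: xE; rewrite xm formE -/t; lra.
    have mN j : (`|m 0%R (lift ord0 j)| < N)%N.
      rewrite -(ltr_nat R); apply: (@lt_le_trans _ _ ((2 * Winv + 1) * E)) => //.
      have Wj : (omega j)^-1 <= Winv.
        by rewrite /Winv (bigD1 j) //= lerDl sumr_ge0 // => i _; rewrite invr_ge0 ltW.
      have jt : (m 0 (lift ord0 j))%:~R * omega j <= t.
        rewrite /t [leRHS](bigD1 j) //= lerDl; apply: sumr_ge0 => i _.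
        by rewrite mulr_ge0 ?ler0z // ltW.
      rewrite natr_absz ger0_norm //.
      have : (m 0 (lift ord0 j))%:~R <= (E + 1) * (omega j)^-1.
        by rewrite ler_pdivlMr //; lra.
      have : (E + 1) * (omega j)^-1 <= (E + 1) * Winv by rewrite ler_pM2l //; lra.
      have : (E + 1) * Winv <= 2 * E * Winv.
        rewrite ler_wpM2r //; last lra.
        by apply: sumr_ge0 => i _; rewrite invr_ge0 ltW.
      lra.
    pose m' : {ffun 'I_d -> 'I_N} := [ffun j => Ordinal (mN j)].
    have wm' : wsum omega m' = t.
      rewrite /wsum /t; apply: eq_bigr => j _; rewrite ffunE /= natr_absz ger0_norm //.
      exact: mulrC.
    apply/mapP; exists m'; first by rewrite mem_enum inE wm'.
    rewrite xm; congr form; apply/rowP => i; rewrite mxE /level_coord.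
    case: (unliftP ord0 i) => [j|] ->; first by rewrite ffunE /= gez0_abs.
    rewrite wm'.
    have -> : Num.ceil (E - t) = m 0 ord0.
      apply: ceil_def; rewrite intrD; move: Ex xE; rewrite xm formE -/t => ? ?.
      by apply/andP; split; lra.
    by apply/esym/max_idPr.
  move=> /mapP[m]; rewrite mem_enum inE => mE ->.
  apply/(mem_levels E _ omega_gt0); split; last exact: level_vector_window.
  by apply/energy_levelP; exists (level_vector E m) => // i; rewrite mxE coord_ge0.
rewrite (permP perm) count_map -sum1_count big_enum_cond -sum1_card.
by apply: eq_bigl => m; rewrite !inE.
Qed.

End Levels.

Section Neighbours.
Variables (R : realType) (d : nat) (omega : 'I_d -> R).
Hypothesis omega_gt0 : forall j, 0 < omega j.
Local Notation lv E := (levels omega E).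

Lemma mem_lv E z : z \in lv E <-> is_level (freq omega) z /\ E <= z < E + 1.
Proof.
split=> [/(mem_levels E z omega_gt0)[/energy_levelP]//|[/energy_levelP zl zE]].
exact/(mem_levels E z omega_gt0).
Qed.

Lemma nth_lv_lt E i j : (i < j)%N -> (j < size (lv E))%N -> nth 0 (lv E) i < nth 0 (lv E) j.
Proof.
move=> ij js; apply: (sorted_ltn_nth lt_trans 0 (levels_sorted omega E)); rewrite ?inE //.
exact: ltn_trans ij js.
Qed.

Lemma nth_lv_le E i j : (i <= j)%N -> (j < size (lv E))%N -> nth 0 (lv E) i <= nth 0 (lv E) j.
Proof. by rewrite leq_eqVlt => /predU1P[->//|ij] js; rewrite ltW // nth_lv_lt. Qed.

Lemma nth_lvP E i : (i < size (lv E))%N ->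
  is_level (freq omega) (nth 0 (lv E) i) /\ E <= nth 0 (lv E) i < E + 1.
Proof. by move=> si; apply/mem_lv; rewrite mem_nth. Qed.

Lemma level_next E i z : (i.+1 < size (lv E))%N -> is_level (freq omega) z ->
  nth 0 (lv E) i < z -> nth 0 (lv E) i.+1 <= z.
Proof.
move=> si zl iz; have [_ /andP[Ei _]] := nth_lvP (ltnW si); have [_ /andP[_ iE]] := nth_lvP si.
have [zE|/(lt_le_trans iE)/ltW//] := ltP z (E + 1).
have /nthP-/(_ 0)[k ks kz] : z \in lv E by apply/mem_lv; rewrite zE (le_trans Ei) // ltW.
rewrite -kz; apply: nth_lv_le => //; rewrite ltnNge; apply/negP => ki.
by have := nth_lv_le ki (ltnW si); rewrite kz leNgt iz.
Qed.

Lemma level_prev E i z : (i.+1 < size (lv E))%N -> is_level (freq omega) z ->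
  z < nth 0 (lv E) i.+1 -> z <= nth 0 (lv E) i.
Proof.
move=> si zl iz; have [_ /andP[Ei _]] := nth_lvP (ltnW si); have [_ /andP[_ iE]] := nth_lvP si.
have [Ez|zE] := leP E z; last by rewrite (le_trans (ltW zE)).
have /nthP-/(_ 0)[k ks kz] : z \in lv E by apply/mem_lv; rewrite Ez (lt_trans iz).
rewrite -kz; apply: nth_lv_le; last exact: ltnW.
by rewrite leqNgt; apply/negP => ik; have := nth_lv_le ik ks; rewrite kz leNgt iz.
Qed.

(** The levels whose jth coordinate is at most E / (d omega j) for every j already
    give a positive proportion of E^d. *)
Lemma many_levels : (forall m m', form (freq omega) m = form (freq omega) m' -> m = m') ->
  (0 < d)%N -> exists2 c : R, 0 < c & forall E, 1 <= E -> c * E ^+ d <= (nlevels omega E)%:R.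
Proof.
move=> form_inj d_gt0.
have dR : 0 < d%:R :> R by rewrite ltr0n.
pose q (E : R) j := E / (d%:R * omega j).
exists (\prod_j (d%:R * omega j)^-1).
  by apply: prodr_gt0 => j _; rewrite invr_gt0 mulr_gt0.
move=> E E1; have E0 : 0 < E by exact: lt_le_trans E1.
have q0 j : 0 <= q E j by rewrite divr_ge0 ?mulr_ge0 // ltW.
pose X := (2 * (\sum_j (omega j)^-1) + 1) * E.
pose N := maxn (Num.truncn X).+1 (\max_j (Num.truncn (q E j)).+1).
have NX : X <= N%:R.
  by rewrite (le_trans (ltW (truncnS_gt _))) // ler_nat leq_maxl.
have cnt := count_levels omega_gt0 form_inj predT E1 NX.
rewrite count_predT -/(nlevels omega E) in cnt; rewrite cnt.
pose F (j : 'I_d) : pred 'I_N := fun x => (x <= Num.truncn (q E j))%N.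
apply: (@le_trans _ _ (#|(family F : simpl_pred {ffun 'I_d -> 'I_N})|%:R)); last first.
  rewrite ler_nat; apply: subset_leq_card; apply/fintype.subsetP => m /familyP mF.
  rewrite inE andbT; apply: (@le_lt_trans _ _ E); last by rewrite ltrDl.
  have -> : E = \sum_(j < d) E / d%:R.
    by rewrite sumr_const card_ord -[RHS]mulr_natr divfK // gt_eqF.
  apply: ler_sum => j _; have := mF j; rewrite unfold_in /F /= truncn_ge_nat // /q.
  by rewrite ler_pdivlMr ?mulr_gt0 // => h; rewrite ler_pdivlMr //; lra.
rewrite card_family foldrE big_map big_enum /= natr_prod.
have -> : E ^+ d = \prod_(j < d) E by rewrite prodr_const card_ord.
rewrite -big_split /=; apply: ler_prod => j _.
rewrite mulr_ge0 ?invr_ge0 ?mulr_ge0 ?(ltW (omega_gt0 _)) ?(ltW E0) //= mulrC -/(q E j).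
have jN : ((Num.truncn (q E j)).+1 <= N)%N by rewrite leq_max (leq_bigmax j) orbT.
suff -> : #|F j| = (Num.truncn (q E j)).+1 by exact: ltW (truncnS_gt _).
rewrite -sum1_card (eq_bigl (fun x : 'I_N => (x < (Num.truncn (q E j)).+1)%N)) //.
by rewrite (big_ord_narrow jN) sum1_card card_ord.
Qed.

End Neighbours.

(** * Ratios of spacings as labels of finite patterns *)
Section Labels.
Variables (R : realType) (d : nat) (omega : 'I_d -> R) (Phi : fieldType).
Variables (iota : {rmorphism Phi -> R}) (val : 'rV[int]_d.+1 -> Phi).
Local Notation b := (freq omega).
Hypothesis omega_gt0 : forall j, 0 < omega j.
Hypothesis iota_val : forall w, iota (val w) = form b w.
Variables (C : R) (lam : R -> R) (U V : R -> 'M[int]_d.+1).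
Hypothesis ren : forall E, 0 < E -> renormalizes b C E (lam E) (U E) (V E).
Variable H : nat.
Hypothesis close_neighbours : forall E x y, 1 <= E ->
  is_level b x -> is_level b y -> E <= x -> x < y -> y < E + 1 ->
  (forall z, is_level b z -> x < z -> y <= z) ->
  exists2 w : 'rV[int]_d.+1, y = x + form b (w *m U E) & forall i, (`|w 0%R i| <= H)%N.

Definition box := {ffun 'I_d.+1 -> 'I_(2 * H).+1}.

Definition boxvec (t : box) : 'rV[int]_d.+1 := \row_i ((t i)%:Z - H%:Z).

Definition boxopp (t : box) : box := [ffun i => rev_ord (t i)].

Lemma boxvec_opp t : boxvec (boxopp t) = - boxvec t.
Proof.
apply/rowP => i; rewrite !mxE ffunE /=; have := ltn_ord (t i); lia.
Qed.

Lemma boxvec_surj (w : 'rV[int]_d.+1) :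
  (forall i, (`|w 0%R i| <= H)%N) -> exists t, boxvec t = w.
Proof.
move=> wH; exists [ffun i => inord `|(w 0 i + H%:Z)%R|%N].
by apply/rowP => i; rewrite mxE ffunE inordK; have := wH i; lia.
Qed.

(** Which of the renormalized box vectors lead from x to another level: this finite
    information determines both neighbours of x. *)
Definition pattern (E x : R) : {ffun box -> bool} :=
  [ffun t => `[< is_level b (x + form b (boxvec t *m U E)) >]].

Definition least (P : {ffun box -> bool}) : option box :=
  [pick t | [&& P t, 0 < form b (boxvec t)
    & [forall u, P u && (0 < form b (boxvec u)) ==> (form b (boxvec t) <= form b (boxvec u))]]].

(** The ratio of spacings read off a pattern P: the nearest level above is given by
    the least vector of P, the nearest one below by the least vector whose opposite
    is in P.  The unit of scale E multiplies both spacings and cancels.  The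
    value 0 is taken on patterns with no neighbour on one side. *)
Definition label (P : {ffun box -> bool}) : Phi :=
  if (least P, least [ffun t => P (boxopp t)]) is (Some t, Some u)
  then val (boxvec t) / val (boxvec u) else 0.

Lemma leastP (P : {ffun box -> bool}) t : P t -> 0 < form b (boxvec t) ->
  (forall u, P u -> 0 < form b (boxvec u) -> form b (boxvec t) <= form b (boxvec u)) ->
  exists2 t', least P = Some t' & form b (boxvec t') = form b (boxvec t).
Proof.
move=> Pt t0 tmin; rewrite /least; case: pickP => [t' /and3P[Pt' t'0 /forallP min']|/(_ t)].
  exists t' => //; apply/eqP; rewrite eq_le tmin // andbT.
  by have := min' t; rewrite Pt t0.
rewrite Pt t0 /= => /negbT/forallPn[u]; rewrite negb_imply => /andP[/andP[Pu u0]].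
by rewrite tmin.
Qed.

(** A box vector in the pattern leads to a level, hence not inside a gap around x,
    and the two gaps themselves are box vectors by close_neighbours. *)
Lemma spacing_ratio_label E i : 1 <= E -> (2 <= i <= (nlevels omega E).-1)%N ->
  spacing_ratio omega E i = iota (label (pattern E (level omega E i))).
Proof.
move=> E1 /andP[]; case: i => [|[|i]] // _ iN; have E0 : 0 < E by exact: lt_le_trans E1.
have {iN} si : (i.+2 < size (levels omega E))%N.
  by move: iN; rewrite /nlevels; case: (size _).
have [_ _ lam0 _ _ _ _] := ren E0.
rewrite /spacing_ratio /spacing /level /=.
have [zl /andP[Ez zE]] := nth_lvP omega_gt0 (ltnW (ltnW si)).
have [xl /andP[Ex xE]] := nth_lvP omega_gt0 (ltnW si).
have [yl /andP[Ey yE]] := nth_lvP omega_gt0 si.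
have xy := nth_lv_lt (ltnSn i.+1) si.
have zx := nth_lv_lt (ltnSn i) (ltnW si).
have nexty u := @level_next _ _ _ omega_gt0 E i.+1 u si.
have nextx u := @level_next _ _ _ omega_gt0 E i u (ltnW si).
have prevz u := @level_prev _ _ _ omega_gt0 E i u (ltnW si).
move: (nth 0 _ i) (nth 0 _ i.+1) (nth 0 _ i.+2)
  zl Ez zE xl Ex xE yl Ey yE xy zx nexty nextx prevz.
move=> z x y zl Ez zE xl Ex xE yl Ey yE xy zx nexty nextx prevz.
have fr w := form_renorm ren w E0.
have [w yw /boxvec_surj[t tw]] := close_neighbours E1 xl yl Ex xy yE nexty.
have [w' xw /boxvec_surj[t' tw']] := close_neighbours E1 zl xl Ez zx xE nextx.
rewrite -{w}tw fr in yw; rewrite -{w'}tw' fr in xw.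
have t_gt0 : 0 < form b (boxvec t) by rewrite -(pmulr_rgt0 _ lam0); lra.
have t'_gt0 : 0 < form b (boxvec t') by rewrite -(pmulr_rgt0 _ lam0); lra.
have patP u : pattern E x u <-> is_level b (x + lam E * form b (boxvec u)).
  by rewrite ffunE fr; split => [/asboolP|h]; last exact/asboolP.
have patN u : pattern E x (boxopp u) <-> is_level b (x - lam E * form b (boxvec u)).
  by rewrite patP boxvec_opp formN mulrN.
have [u least_u uE] : exists2 u, least (pattern E x) = Some u
    & form b (boxvec u) = form b (boxvec t).
  have Pt : pattern E x t by apply/patP; rewrite -yw.
  apply: (leastP Pt t_gt0) => u /patP/nexty h u0; rewrite -(ler_pM2l lam0).
  have : x < x + lam E * form b (boxvec u) by rewrite ltrDl mulr_gt0.
  by move/h; lra.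
have [u' least_u' u'E] : exists2 u, least [ffun t => pattern E x (boxopp t)] = Some u
    & form b (boxvec u) = form b (boxvec t').
  have Pt' : [ffun t => pattern E x (boxopp t)] t'.
    by rewrite ffunE; apply/patN; rewrite xw addrK.
  apply: (leastP Pt' t'_gt0) => v; rewrite ffunE => /patN/prevz h v0.
  rewrite -(ler_pM2l lam0).
  have : x - lam E * form b (boxvec v) < x by rewrite gtrBl mulr_gt0.
  by move/h; lra.
have e1 : y - x = lam E * form b (boxvec t) by lra.
have e2 : x - z = lam E * form b (boxvec t') by lra.
rewrite e1 e2 -mulf_div divff ?mul1r ?gt_eqF //.
by rewrite /label least_u least_u' fmorph_div !iota_val uE u'E.
Qed.

End Labels.

(** * Extending an almost Lipschitz function of the phase *)
Section Retraction.
Variables (R : realType) (J : nat).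
Implicit Types v w : 'rV[R]_J.+1.

Definition possum v : R := \sum_j Num.max 0 (v 0 j).

(** A Lipschitz retraction onto the simplex: negative entries are cut, a sum larger
    than 1 is normalized, and a sum smaller than 1 is completed in the entry ord0. *)
Definition to_simplex v : 'rV[R]_J.+1 :=
  \row_j (Num.max 0 (v 0 j) / Num.max 1 (possum v)
          + (if j == ord0 then 1 - Num.min 1 (possum v) else 0)).

Lemma possum_ge0 v : 0 <= possum v.
Proof. by apply: sumr_ge0 => j _; rewrite le_max lexx. Qed.

Lemma to_simplexP v : simplex (to_simplex v).
Proof.
have s0 := possum_ge0 v; have M1 : 1 <= Num.max 1 (possum v) by rewrite le_max lexx.
split.
  under eq_bigr do rewrite mxE.
  rewrite big_split /= -mulr_suml -/(possum v) -big_mkcond big_pred1_eq.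
  have [s1|s1] := leP (possum v) 1; first by rewrite divr1; lra.
  by rewrite divff ?gt_eqF; lra.
move=> j; rewrite mxE addr_ge0 ?divr_ge0 ?le_max ?lexx ?ler01 //.
by case: ifP => // _; rewrite subr_ge0 ge_min lexx.
Qed.

Lemma to_simplex_id v : simplex v -> to_simplex v = v.
Proof.
move=> [v1 v0]; have s1 : possum v = 1.
  by rewrite -v1; apply: eq_bigr => j _; rewrite (max_idPr _).
apply/rowP => j; rewrite mxE s1 maxxx minxx subrr divr1 (max_idPr _) //.
by case: ifP; rewrite addr0.
Qed.

Lemma max0_lipschitz (x y : R) : `|Num.max 0 x - Num.max 0 y| <= `|x - y|.
Proof.
have h1 := ler_norm (x - y); have h2 := ler_norm (y - x); rewrite distrC in h2.
rewrite ler_norml; case: (leP 0 x) => x0; case: (leP 0 y) => y0;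
  by apply/andP; split; lra.
Qed.

Lemma to_simplex_lipschitz v w e : (forall j, `|v 0 j - w 0 j| <= e) ->
  forall j, `|to_simplex v 0 j - to_simplex w 0 j| <= (2 * J.+1%:R + 1) * e.
Proof.
move=> vw j; have e0 : 0 <= e by exact: le_trans (normr_ge0 _) (vw ord0).
have qe i : `|Num.max 0 (v 0 i) - Num.max 0 (w 0 i)| <= e.
  exact: le_trans (max0_lipschitz _ _) (vw i).
have se : `|possum v - possum w| <= J.+1%:R * e.
  rewrite /possum -sumrB; apply: (le_trans (ler_norm_sum _ _ _)).
  by apply: le_trans (ler_sum _ (fun i _ => qe i)) _; rewrite sumr_const card_ord mulr_natl.
have qs (u : 'rV[R]_J.+1) : Num.max 0 (u 0 j) <= possum u.
  by rewrite /possum (bigD1 j) //= lerDl; apply: sumr_ge0 => i _; rewrite le_max lexx.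
have := qe j; have := qs v; have := qs w; have := possum_ge0 v; have := possum_ge0 w.
rewrite !mxE; have : 0 <= Num.max 0 (v 0 j) by rewrite le_max lexx.
have : 0 <= Num.max 0 (w 0 j) by rewrite le_max lexx.
move: se; move: (Num.max 0 (v 0 j)) (Num.max 0 (w 0 j)) (possum v) (possum w).
move=> q q' s s' se q'0 q0 s'0 s0 qs' qs_ qq.
have Me : `|Num.max 1 s - Num.max 1 s'| <= J.+1%:R * e.
  move: se; rewrite !ler_norml => /andP[a1 a2]; apply/andP.
  by case: (leP 1 s) => s1; case: (leP 1 s') => s1'; split; lra.
have me : `|Num.min 1 s - Num.min 1 s'| <= J.+1%:R * e.
  move: se; rewrite !ler_norml => /andP[a1 a2]; apply/andP.
  by case: (leP 1 s) => s1; case: (leP 1 s') => s1'; split; lra.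
have [M1 sM] : 1 <= Num.max 1 s /\ s <= Num.max 1 s by rewrite !le_max !lexx orbT.
have [M1' sM'] : 1 <= Num.max 1 s' /\ s' <= Num.max 1 s' by rewrite !le_max !lexx orbT.
move: (Num.max 1 s) (Num.max 1 s') Me M1 sM M1' sM' => M M' Me M1 sM M1' sM'.
have M0 : 0 < M by exact: lt_le_trans M1.
have M0' : 0 < M' by exact: lt_le_trans M1'.
have iM : 0 < M^-1 by rewrite invr_gt0.
have qM : `|q / M - q' / M'| <= e + J.+1%:R * e.
  rewrite (_ : _ - _ = (q - q') / M + q' / M' * ((M' - M) / M)); last by field; rewrite !gt_eqF.
  apply: (le_trans (ler_normD _ _)); apply: lerD.
    by rewrite normrM (gtr0_norm iM) ler_pdivrMr // (le_trans qq) // ler_peMr.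
  rewrite !normrM -[leRHS]mul1r; apply: ler_pM => //.
    rewrite -normrM ger0_norm; last by rewrite divr_ge0 // ltW.
    by rewrite ler_pdivrMr // mul1r (le_trans qs').
  rewrite distrC in Me; rewrite (gtr0_norm iM) ler_pdivrMr //.
  by rewrite (le_trans Me) // ler_peMr ?mulr_ge0.
have mm : `|(if j == ord0 then 1 - Num.min 1 s else 0)
    - (if j == ord0 then 1 - Num.min 1 s' else 0)| <= J.+1%:R * e.
  case: ifP => _; last by rewrite subrr normr0 mulr_ge0.
  by rewrite (_ : _ - _ = - (Num.min 1 s - Num.min 1 s')) ?normrN //; ring.
rewrite opprD addrACA (le_trans (ler_normD _ _)) //.
by apply: le_trans (lerD qM mm) _; lra.
Qed.

End Retraction.

Section Extension.
Variables (R : realType) (k s J : nat) (theta : 'rV[R]_k) (beta : 'rV[R]_s).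
Variables (p : R -> 'rV[R]_J.+1) (K E0 : R).
Hypotheses (E0_ge1 : 1 <= E0) (K_ge0 : 0 <= K).
Hypothesis p_simplex : forall E, E0 <= E -> simplex (p E).
Hypothesis p_almost_lipschitz : forall E E' j, E0 <= E -> E0 <= E' ->
  `|p E 0 j - p E' 0 j| <= K * (phase_dist theta beta E E' + E^-1 + E'^-1).

Let tor E : 'rV[circle R]_k := to_torus (ln E *: theta).
Let fr E : 'rV[R]_s := map_mx frac (ln E *: beta).

Let candidates x y j : set R := [set z | exists2 E, E0 <= E &
  z = p E 0 j + K * (torus_dist (tor E) x + `|fr E - y| + E^-1)].

(** McShane's extension from the phases of the energies above E0, with the extra
    term K / E absorbing the error in p_almost_lipschitz. *)
Let inf_ext x y : 'rV[R]_J.+1 := \row_j inf (candidates x y j).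

Let candidates_ge0 x y j z : candidates x y j z -> 0 <= z.
Proof.
move=> [E EE ->]; have [_ /(_ j) p0] := p_simplex EE.
rewrite addr_ge0 // mulr_ge0 // !addr_ge0 ?torus_dist_ge0 // invr_ge0.
by rewrite (le_trans _ EE) // (le_trans _ E0_ge1).
Qed.

Let candidates_has_inf x y j : has_inf (candidates x y j).
Proof.
split; last by exists 0 => z; exact: candidates_ge0.
by exists (p E0 0 j + K * (torus_dist (tor E0) x + `|fr E0 - y| + E0^-1)), E0.
Qed.

Let inf_ext_lipschitz x y x' y' j :
  inf_ext x y 0 j - inf_ext x' y' 0 j <= K * (torus_dist x' x + `|y' - y|).
Proof.
rewrite lerBlDr -lerBlDl [inf_ext x' y']lock !mxE -lock mxE.
apply: lb_le_inf; first by case: (candidates_has_inf x' y' j).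
move=> z [E EE ->]; rewrite lerBlDl.
have [_ lb] := candidates_has_inf x y j.
apply: le_trans (ge_inf lb (_ : candidates x y j
  (p E 0 j + K * (torus_dist (tor E) x + `|fr E - y| + E^-1)))) _.
  by exists E.
rewrite addrCA lerD2l -mulrDr ler_wpM2l //.
have := torus_dist_triangle (tor E) x' x; have := ler_distD y' (fr E) y.
lra.
Qed.

Let inf_ext_near E j : E0 <= E -> `|p E 0 j - inf_ext (tor E) (fr E) 0 j| <= K * E^-1.
Proof.
move=> EE; rewrite distrC ler_norml mxE; apply/andP; split.
  rewrite lerBrDl; apply: lb_le_inf; first by case: (candidates_has_inf (tor E) (fr E) j).
  move=> z [E' EE' ->]; have := p_almost_lipschitz j EE EE'.
  rewrite /phase_dist -/(tor _) -/(tor _) -/(fr _) -/(fr _) ler_norml => /andP[_].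
  have := torus_dist_sym (tor E) (tor E'); rewrite (distrC (fr E)) => h1 h2.
  have : K * torus_dist (tor E) (tor E') <= K * torus_dist (tor E') (tor E).
    by rewrite ler_wpM2l.
  lra.
have [_ lb] := candidates_has_inf (tor E) (fr E) j.
rewrite lerBlDl; apply: ge_inf => //; exists E => //.
by rewrite torus_distxx subrr normr0 !add0r.
Qed.

(** The infimum formula defines a Lipschitz function everywhere, which agrees with p
    at the phase of E up to K / E; its values are pushed into the simplex by the
    retraction, which fixes the values of p. *)
Lemma extension : exists h : 'rV[circle R]_k -> 'rV[R]_s -> 'rV[R]_J.+1,
  [/\ forall x y, simplex (h x y), torus_cube_lipschitz h
    & exists C, forall E j, E0 <= E ->
        `|p E 0 j - h (to_torus (ln E *: theta)) (map_mx frac (ln E *: beta)) 0 j| <= C / E].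
Proof.
exists (fun x y => to_simplex (inf_ext x y)); split.
- by move=> x y; exact: to_simplexP.
- exists ((2 * J.+1%:R + 1) * (2 * K)) => x x' y y' _ _.
  set m := Num.max _ _.
  have [m1 m2] : torus_dist x x' <= m /\ `|y - y'| <= m by rewrite !le_max !lexx orbT.
  have m0 : 0 <= m by exact: le_trans m2.
  have m1' := le_trans (torus_dist_sym x' x) m1.
  have half (a b : R) : a <= m -> b <= m -> K * (a + b) <= 2 * K * m.
    move=> am bm; have -> : 2 * K * m = K * (m + m) by ring.
    by rewrite ler_wpM2l // lerD.
  apply: row_norm_le; first by rewrite mulr_ge0 // ?mulr_ge0 ?addr_ge0 ?mulr_ge0.
  move=> j; rewrite mxE [X in _ + X]mxE -mulrA.
  apply: to_simplex_lipschitz => i; rewrite ler_norml; apply/andP; split; last first.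
    by apply: le_trans (inf_ext_lipschitz x y x' y' i) _; apply: half => //; rewrite distrC.
  by rewrite lerNl opprB; apply: le_trans (inf_ext_lipschitz x' y' x y i) _; apply: half.
- exists ((2 * J.+1%:R + 1) * K) => E j EE.
  rewrite -{1}(to_simplex_id (p_simplex EE)) -mulrA.
  by apply: to_simplex_lipschitz => i; exact: inf_ext_near.
Qed.

End Extension.

(** * Proportions of ratios and the main theorem *)
Lemma finite_range_enum (T : finType) (X : eqType) (f : T -> X) (t0 : T) :
  exists (J : nat) (r : 'I_J.+1 -> X), injective r /\ forall t, exists j, f t = r j.
Proof.
pose s := undup (codom f).
have fs t : f t \in s by rewrite mem_undup codom_f.
case sE : (size s) => [|J]; first by have := fs t0; rewrite (size0nil sE).
exists J, (fun j => nth (f t0) s j); split.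
  move=> i j /eqP; rewrite nth_uniq ?undup_uniq ?sE // => /eqP; exact: val_inj.
move=> t; have ft : (index (f t) s < J.+1)%N by rewrite -sE index_mem.
by exists (Ordinal ft); rewrite /= nth_index.
Qed.

Lemma quotient_lipschitz (R : realFieldType) (c e x x' y y' : R) : 0 < c -> c <= y -> c <= y' ->
  0 <= x' <= y' -> `|x - x'| <= e -> `|y - y'| <= e -> `|x / y - x' / y'| <= 2 * e / c.
Proof.
move=> c0 cy cy' /andP[x'0 x'y'] xx' yy'.
have y0 : 0 < y by exact: lt_le_trans cy.
have y0' : 0 < y' by exact: lt_le_trans cy'.
have yc : y^-1 <= c^-1 by rewrite lef_pV2.
have iy : 0 < y^-1 by rewrite invr_gt0.
rewrite (_ : _ - _ = (x - x') / y + x' / y' * ((y' - y) / y)); last first.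
  by field; rewrite !gt_eqF.
rewrite (_ : 2 * e / c = e / c + 1 * (e / c)); last by ring.
apply: (le_trans (ler_normD _ _)); apply: lerD.
  by rewrite normrM (gtr0_norm iy); apply: ler_pM => //; exact: ltW.
rewrite normrM; apply: ler_pM => //.
  by rewrite ger0_norm ?divr_ge0 ?(ltW y0') // ler_pdivrMr // mul1r.
by rewrite normrM (gtr0_norm iy) distrC; apply: ler_pM => //; exact: ltW.
Qed.

(** The ratios are indexed by the levels of the window that are neither first nor
    last; here a counts such levels and t counts among all n of them. *)
Lemma trimmed_proportion (R : realFieldType) (a t n : nat) : (4 <= n)%N -> (a <= n - 2)%N ->
  (a <= t <= a + 2)%N -> (t <= n)%N ->
  `|a%:R / (n - 2)%N%:R - t%:R / n%:R| <= 4 / n%:R :> R.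
Proof.
move=> n4 an /andP[at_ ta] tn.
have n2 : (n - 2)%:R = n%:R - 2 :> R by rewrite natrB // ltnW // ltnW.
have n4R : 4 <= n%:R :> R by rewrite (ler_nat R 4).
move: at_ ta tn an; rewrite -!(ler_nat R) natrD n2.
have : 0 <= a%:R :> R by [].
move: (a%:R) (t%:R) (n%:R : R) n4R => x y z z4 x0 xy yx yz xz.
have z0 : 0 < z by lra.
have z20 : 0 < z - 2 by lra.
rewrite (_ : _ - _ = (x * z - y * (z - 2)) / ((z - 2) * z)); last by field; rewrite !gt_eqF.
have p0 : 0 < (z - 2) * z by rewrite mulr_gt0.
rewrite normrM (gtr0_norm (_ : 0 < ((z - 2) * z)^-1)) ?invr_gt0 // ler_pdivrMr //.
rewrite (_ : 4 / z * _ = 4 * (z - 2)); last by field; rewrite gt_eqF.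
by rewrite ler_norml; apply/andP; split; nra.
Qed.

Section Counting.
Variables (R : realType) (d : nat) (omega : 'I_d -> R) (Phi : fieldType).
Variables (iota : {rmorphism Phi -> R}) (val : 'rV[int]_d.+1 -> Phi).
Local Notation b := (freq omega).
Hypothesis d_gt0 : (0 < d)%N.
Hypothesis omega_gt0 : forall j, 0 < omega j.
Hypothesis iota_val : forall w, iota (val w) = form b w.
Hypothesis form_inj : forall m m', form b m = form b m' -> m = m'.
Variables (C : R) (lam : R -> R) (U V : R -> 'M[int]_d.+1).
Hypothesis C_gt0 : 0 < C.
Hypothesis ren : forall E, 0 < E -> renormalizes b C E (lam E) (U E) (V E).
Variables (s : nat) (theta : 'rV[R]_d.+1) (beta : 'rV[R]_s).
Hypothesis quasi : forall E E' i j, 1 <= E -> 1 <= E' ->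
  `|(U E i j)%:~R / E - (U E' i j)%:~R / E'| <=
    C * (phase_dist theta beta E E' + E^-1 + E'^-1).
Variable H : nat.
Hypothesis close_neighbours : forall E x y, 1 <= E ->
  is_level b x -> is_level b y -> E <= x -> x < y -> y < E + 1 ->
  (forall z, is_level b z -> x < z -> y <= z) ->
  exists2 w : 'rV[int]_d.+1, y = x + form b (w *m U E) & forall i, (`|w 0%R i| <= H)%N.

Local Notation box := (box d H).
Local Notation pattern := (@pattern R d omega U H).
Local Notation label := (@label R d omega Phi val H).
Local Notation lv E := (levels omega E).

(** Adding w *m U E to a level gives a level when each coordinate is at least the
    opposite of the same coordinate of w *m U E; in units of E this is a wall. *)
Definition threshold (E : R) (ti : box * 'I_d.+1) : R :=
  - ((boxvec ti.1 *m U E) 0 ti.2)%:~R / E.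

Lemma pattern_coord E N (m : {ffun 'I_d -> 'I_N}) t : 1 <= E ->
  pattern E (form b (level_vector omega E m)) t =
  [forall i, threshold E (t, i) * E <= (level_coord omega E m i)%:~R].
Proof.
move=> E1; have E0 : E != 0 by rewrite gt_eqF // (lt_le_trans _ E1).
have levE i w : (level_vector omega E m + w) 0 i = level_coord omega E m i + w 0 i.
  by rewrite mxE [X in X + _]mxE.
have thrE i : (threshold E (t, i) * E <= (level_coord omega E m i)%:~R) =
    (0 <= (level_vector omega E m + boxvec t *m U E) 0 i).
  by rewrite levE /threshold /= divfK // -rmorphN /= ler_int lerNl -subr_ge0 opprK addrC.
rewrite ffunE -formD; apply/asboolP/forallP => [[m' m'_ge0 /form_inj mm'] i|h].
  by rewrite thrE mm'.
by exists (level_vector omega E m + boxvec t *m U E) => // i; rewrite -thrE; exact: h.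
Qed.

Lemma count_pattern E N (Q : {ffun box -> bool} -> bool) : 1 <= E ->
  (2 * (\sum_j (omega j)^-1) + 1) * E <= N%:R ->
  count (fun x => Q (pattern E x)) (lv E) =
  #|cell omega snd E (threshold E) (fun P => Q [ffun t => [forall i, P (t, i)]]) (N := N)|.
Proof.
move=> E1 NE; rewrite (count_levels omega_gt0 form_inj _ E1 NE).
apply: eq_card => m; rewrite !inE; congr (_ && Q _).
apply/ffunP => t; rewrite pattern_coord // [RHS]ffunE.
by apply: eq_forallb => i; rewrite ffunE.
Qed.

(** This is where quasiperiodicity enters: the walls move with the entries of U E / E,
    which are Lipschitz functions of the phase up to O(1/E). *)
Lemma threshold_quasi E E' ti : 1 <= E -> 1 <= E' ->
  `|threshold E ti - threshold E' ti| <=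
    (d.+1%:R * H%:R * C) * (phase_dist theta beta E E' + E^-1 + E'^-1).
Proof.
case: ti => t i E1 E1'; rewrite /threshold /=.
have -> : - ((boxvec t *m U E) 0 i)%:~R / E - - ((boxvec t *m U E') 0 i)%:~R / E' =
    - \sum_k (boxvec t 0 k)%:~R * ((U E k i)%:~R / E - (U E' k i)%:~R / E').
  rewrite !mxE !rmorph_sum /= !mulNr opprK addrC !mulr_suml -opprB -sumrB; congr (- _).
  by apply: eq_bigr => k _; rewrite !rmorphM /= mulrBr !mulrA.
rewrite normrN; apply: (le_trans (ler_norm_sum _ _ _)).
apply: (@le_trans _ _ (\sum_(k < d.+1)
  H%:R * (C * (phase_dist theta beta E E' + E^-1 + E'^-1)))).
  apply: ler_sum => k _; rewrite normrM; apply: ler_pM => //; last exact: quasi.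
  rewrite -intr_norm -natr_absz ler_nat mxE; have := ltn_ord (t k); lia.
by rewrite sumr_const card_ord -[leLHS]mulr_natl !mulrA.
Qed.

Lemma count_quasi : exists2 K : R, 0 <= K & forall E E' (Q : {ffun box -> bool} -> bool),
  1 <= E -> 1 <= E' ->
  `|(count (fun x => Q (pattern E x)) (lv E))%:R / E ^+ d
    - (count (fun x => Q (pattern E' x)) (lv E'))%:R / E' ^+ d|
  <= K * (phase_dist theta beta E E' + E^-1 + E'^-1).
Proof.
have [K K_ge0 KP] := compare_cells d_gt0 omega_gt0 (snd : box * 'I_d.+1 -> _).
pose K2 := d.+1%:R * H%:R * C.
have K2_ge0 : 0 <= K2 by rewrite !mulr_ge0 // ltW.
exists (K * (K2 + 1)); first by rewrite mulr_ge0 // addr_ge0.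
move=> E E' Q E1 E1'.
pose X := 2 * (\sum_j (omega j)^-1) + 1.
have NX F : X * F <= (Num.truncn (X * F)).+1%:R by exact: ltW (truncnS_gt _).
rewrite (count_pattern _ E1 (NX E)) (count_pattern _ E1' (NX E')).
set D := phase_dist theta beta E E' + E^-1 + E'^-1.
have iE : 0 <= E^-1 by rewrite invr_ge0 (le_trans _ E1).
have iE' : 0 <= E'^-1 by rewrite invr_ge0 (le_trans _ E1').
have D0 := phase_dist_ge0 theta beta E E'.
have D_ge0 : 0 <= D by rewrite /D; lra.
have K2D : 0 <= K2 * D by rewrite mulr_ge0.
apply: le_trans (KP E E' _ _ (K2 * D) _ _ _ E1 E1' _ K2D (NX E) (NX E')) _.
  by move=> ti; exact: threshold_quasi.
by rewrite -mulrA ler_wpM2l // mulrDl mul1r /D; lra.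
Qed.

Definition label_count E r : nat := count (fun x => label (pattern E x) == r) (lv E).

Definition ratio_count E r : nat :=
  (\sum_(2 <= i < nlevels omega E) (spacing_ratio omega E i == iota r))%N.

Lemma ratio_count_label E r : 1 <= E ->
  (ratio_count E r <= label_count E r <= ratio_count E r + 2)%N.
Proof.
move=> E1; pose g k : nat := label (pattern E (nth 0 (lv E) k)) == r.
have -> : label_count E r = (\sum_(0 <= k < nlevels omega E) g k)%N.
  rewrite /label_count -sum1_count big_mkcond (big_nth 0) /=.
  by apply: eq_bigr => k _; rewrite /g; case: eqP.
have -> : ratio_count E r = (\sum_(2 <= i < nlevels omega E) g i.-1)%N.
  rewrite /ratio_count; apply: eq_big_nat => i /andP[i2 iN].
  rewrite (spacing_ratio_label omega_gt0 iota_val ren close_neighbours E1).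
    by rewrite (inj_eq (fmorph_inj iota)).
  by rewrite i2 /=; move: iN; case: (nlevels _ _).
have g1 k : (g k <= 1)%N by rewrite /g; case: eqP.
case: (nlevels omega E) => [|[|n]].
- by rewrite !big_geq.
- by rewrite big_geq // big_nat1; have := g1 0%N; lia.
have -> : (\sum_(2 <= i < n.+2) g i.-1 = \sum_(0 <= k < n) g k.+1)%N by rewrite 2!big_add1.
have -> : (\sum_(0 <= k < n.+2) g k = g 0 + (\sum_(0 <= k < n) g k.+1 + g n.+1))%N.
  by rewrite big_nat_recl // big_nat_recr.
have := g1 0%N; have := g1 n.+1; lia.
Qed.

(** Numerator and denominator of a proportion, divided by E^d, are almost Lipschitz
    functions of the phase, and the denominator stays away from 0. *)
Lemma proportion_quasi : exists (K E0 : R), [/\ 1 <= E0, 0 <= K,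
  forall E, E0 <= E -> (2 < nlevels omega E)%N &
  forall E E' r, E0 <= E -> E0 <= E' ->
  `|ratio_proportion omega E (iota r) - ratio_proportion omega E' (iota r)|
  <= K * (phase_dist theta beta E E' + E^-1 + E'^-1)].
Proof.
have [K K_ge0 KP] := count_quasi.
have [c c_gt0 cP] := many_levels omega_gt0 form_inj d_gt0.
have ic : 0 < c^-1 by rewrite invr_gt0.
have big E : 1 + 4 / c <= E ->
    [/\ 1 <= E, c * E <= (nlevels omega E)%:R & (4 <= nlevels omega E)%N].
  move=> EE; have E1 : 1 <= E by apply: le_trans EE; rewrite lerDl divr_ge0 // ltW.
  have cE : c * E <= (nlevels omega E)%:R.
    apply: le_trans (cP E E1); rewrite ler_pM2l // -{1}[E]expr1.
    by apply: ler_weXn2l.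
  split => //; rewrite -(ler_nat R) (le_trans _ cE) //.
  rewrite mulrC -ler_pdivrMr // (le_trans _ EE) // lerDr.
  exact: ler01.
exists (2 * K / c + 4 / c), (1 + 4 / c); split.
- by rewrite lerDl divr_ge0 // ltW.
- by rewrite addr_ge0 // divr_ge0 ?mulr_ge0 // ltW.
- by move=> E /big[_ _]; exact: ltn_trans.
move=> E E' r EE EE'.
pose q E := (label_count E r)%:R / (nlevels omega E)%:R : R.
have near E1 : 1 + 4 / c <= E1 -> `|ratio_proportion omega E1 (iota r) - q E1| <= 4 / c * E1^-1.
  move=> /big[E1_ge1 cE n4]; have E1_gt0 : 0 < E1 by exact: lt_le_trans E1_ge1.
  rewrite /ratio_proportion -/(ratio_count E1 r) /q.
  have Sn : (label_count E1 r <= nlevels omega E1)%N by exact: count_size.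
  have An : (ratio_count E1 r <= nlevels omega E1 - 2)%N.
    rewrite /ratio_count; apply: (@leq_trans (\sum_(2 <= i < nlevels omega E1) 1)%N).
      by apply: leq_sum => i _; case: eqP.
    by rewrite sum_nat_const_nat muln1.
  apply: le_trans (trimmed_proportion R n4 An (ratio_count_label r E1_ge1) Sn) _.
  have n0 : 0 < (nlevels omega E1)%:R :> R by rewrite ltr0n (leq_trans _ n4).
  by rewrite -mulrA ler_pM2l // -invfM lef_pV2 ?posrE ?mulr_gt0.
have [E1 cE n4] := big E EE; have [E1' cE' n4'] := big E' EE'.
have E_gt0 : 0 < E by exact: lt_le_trans E1.
have E_gt0' : 0 < E' by exact: lt_le_trans E1'.
set D := phase_dist theta beta E E' + E^-1 + E'^-1.
have qq : `|q E - q E'| <= 2 * K / c * D.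
  have h1 := KP E E' (fun P => label P == r) E1 E1'.
  rewrite -/(label_count E r) -/(label_count E' r) -/D in h1.
  have h2 := KP E E' (fun=> true) E1 E1'; rewrite !count_predT -!/(nlevels _ _) -/D in h2.
  have h3 := cP E E1; rewrite -ler_pdivlMr ?exprn_gt0 // in h3.
  have h4 := cP E' E1'; rewrite -ler_pdivlMr ?exprn_gt0 // in h4.
  have h5 : (label_count E' r)%:R / E' ^+ d <= (nlevels omega E')%:R / E' ^+ d.
    by rewrite ler_wpM2r ?invr_ge0 ?exprn_ge0 ?(ltW E_gt0') // ler_nat count_size.
  have h6 : 0 <= (label_count E' r)%:R / E' ^+ d by rewrite divr_ge0 // exprn_ge0 // ltW.
  have qE F : 0 < F -> q F = ((label_count F r)%:R / F ^+ d) / ((nlevels omega F)%:R / F ^+ d).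
    by move=> F0; rewrite /q -mulf_div divff ?mulr1 // invr_eq0 expf_neq0 // gt_eqF.
  rewrite !qE // (_ : 2 * K / c * D = 2 * (K * D) / c); last by ring.
  by apply: (quotient_lipschitz c_gt0 h3 h4 _ h1 h2); rewrite h6.
have iE : 0 <= E^-1 by rewrite invr_ge0 ltW.
have iE' : 0 <= E'^-1 by rewrite invr_ge0 ltW.
have D0 := phase_dist_ge0 theta beta E E'.
have cD : 4 / c * (E^-1 + E'^-1) <= 4 / c * D by rewrite ler_pM2l ?divr_gt0 // /D; lra.
have := near E EE; have := near E' EE'; rewrite !ler_norml => /andP[? ?] /andP[? ?].
by move: qq; rewrite ler_norml => /andP[? ?]; apply/andP; split; lra.
Qed.

End Counting.

Theorem theoremB (R : realType) (Phi : fieldExtType rat)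
    (iota : {rmorphism Phi -> R}) (d : nat) (d_ge1 : (1 <= d)%N)
    (omega : 'I_d -> Phi)
    (omega_gt0 : forall j, 0 < iota (omega j))
    (omega_basis : basis_of fullv (1 :: codom omega)) :
  exists (J : nat) (r : 'I_J -> Phi),
    [/\ injective r,
        forall E : R, 1 < E ->
          forall i : nat, (2 <= i <= (nlevels (iota \o omega) E).-1)%N ->
            exists j, spacing_ratio (iota \o omega) E i = iota (r j)
      & exists (k s : nat) (h : 'rV[circle R]_k -> 'rV[R]_s -> 'rV[R]_J)
               (theta : 'rV[R]_k) (beta : 'rV[R]_s) (alpha : R),
          [/\ (k <= d.+1)%N /\ (s <= d.+1)%N,
              forall x y, unit_cube y -> simplex (h x y),
              torus_cube_lipschitz h,
              0 < alpha < 1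
            & forall j, exists C : R, \forall E \near +oo,
                `|ratio_proportion (iota \o omega) E (iota (r j))
                  - h (to_torus (ln E *: theta))
                      (map_mx frac (ln E *: beta)) 0 j|
                <= C * alpha `^ ln E]].
Proof.
pose w := iota \o omega.
have size_b : size (1 :: codom omega) == d.+1 by rewrite /= size_codom card_ord.
pose b := Tuple size_b.
have b_freq (i : 'I_d.+1) : iota b`_i = freq w i.
  rewrite /freq; case: (unliftP ord0 i) => [j|] ->; last by rewrite rmorph1.
  rewrite /= /codom /image_mem (nth_map j); last by rewrite size_enum_ord add0n.
  exact: (congr1 (fun i => iota (omega i)) (nth_ord_enum j j)).
have freqE : (fun i : 'I_d.+1 => iota b`_i) = freq w by apply/funext => k; exact: b_freq.
have [s [theta [beta [C [lam [U [V [s_le C_gt0 ren quasi]]]]]]]] :=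
  renormalization iota (omega_basis : basis_of fullv b).
rewrite freqE in ren.
pose val (m : 'rV[int]_d.+1) : Phi := \sum_i (m 0 i)%:~R * b`_i.
have iota_val m : iota (val m) = form (freq w) m.
  by rewrite rmorph_sum; apply: eq_bigr => i _; rewrite rmorphM rmorph_int b_freq.
have form_inj m m' : form (freq w) m = form (freq w) m' -> m = m'.
  rewrite -!iota_val => /fmorph_inj /eqP; rewrite -subr_eq0 -sumrB => /eqP mm'.
  have /freeP free_b := basis_free (omega_basis : basis_of fullv b).
  apply/rowP => i; have := free_b (fun i => (m 0 i - m' 0 i)%:~R) _ i.
  move/(_ _)/eqP; rewrite intr_eq0 subr_eq0 => h; apply/eqP/h.
  by rewrite -[RHS]mm'; apply: eq_bigr => k _; rewrite scaler_int -mulrzl rmorphB mulrBl.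
have [H close_neighbours] := neighbour_difference (freq0 w) (freq_gt0 omega_gt0) C_gt0 ren.
have [J [r [r_inj label_r]]] :=
  finite_range_enum (@label R d w Phi val H) [ffun=> true].
exists J.+1, r.
have ratios E : 1 <= E -> forall i, (2 <= i <= (nlevels w E).-1)%N ->
    exists j, spacing_ratio w E i = iota (r j).
  move=> E1 i iN; rewrite (spacing_ratio_label omega_gt0 iota_val ren close_neighbours E1 iN).
  by have [j ->] := label_r (pattern w U H E (level w E i)); exists j.
split => //; first by move=> E /ltW; exact: ratios.
have [K [E0 [E0_ge1 K_ge0 E0_levels pq]]] :=
  proportion_quasi d_ge1 omega_gt0 iota_val form_inj C_gt0 ren quasi close_neighbours.
pose p E : 'rV[R]_J.+1 := \row_j ratio_proportion w E (iota (r j)).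
have p_simplex E : E0 <= E -> simplex (p E).
  move=> EE; have n2 := E0_levels E EE.
  have n2R : (nlevels w E - 2)%N%:R != 0 :> R by rewrite pnatr_eq0 -lt0n subn_gt0.
  split; last by move=> j; rewrite mxE divr_ge0.
  under eq_bigr do rewrite mxE.
  rewrite -mulr_suml -natr_sum exchange_big /=.
  rewrite (eq_big_nat _ _ (F2 := fun=> 1%N)) => [|i /andP[i2 iN]].
    by rewrite sum_nat_const_nat muln1 divff.
  have [|j ij] := ratios E (le_trans E0_ge1 EE) i.
    by rewrite i2 /=; move: iN; case: (nlevels _ _).
  rewrite (bigD1 j) //= ij eqxx big1 // => j' /negPf j'j.
  by rewrite (inj_eq (fmorph_inj iota)) (inj_eq r_inj) eq_sym j'j.
have p_quasi E E' j : E0 <= E -> E0 <= E' ->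
    `|p E 0 j - p E' 0 j| <= K * (phase_dist theta beta E E' + E^-1 + E'^-1).
  by move=> EE EE'; rewrite !mxE; exact: pq.
have [h [h_simplex h_lip [C' hC']]] := extension E0_ge1 K_ge0 p_simplex p_quasi.
exists d.+1, s, h, theta, beta, (expR (-1)); split => //.
  by rewrite expR_gt0 /= expR_lt1 oppr_lt0 ltr01.
move=> j; exists C'; near=> E.
have EE : E0 <= E by near: E; apply: nbhs_pinfty_ge; rewrite num_real.
have E_gt0 : 0 < E by rewrite (lt_le_trans _ EE) // (lt_le_trans _ E0_ge1).
rewrite -expRM mulN1r expRN lnK //; have := hC' E j EE; rewrite mxE; exact.
Unshelve. all: by end_near.
Qed.
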